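(* Let $u\in X_p$ and $z\in X_d$ be the solutions of the primal and adjoint weak problems, $\sigma=-A\nabla u-f_2$, $r=-(A\nabla z+bz+g_2)$, and $\gamma=\mathcal J_p(u)$. Let $w\in X_p$ and $v\in X_d$, and let $\tau,\rho\in L^2(\Omega)^d$ be arbitrary. Then the corrected quantity $\gamma_1(w,\tau,v,\rho)$ satisfies $$\gamma-\gamma_1(w,\tau,v,\rho)=\bigl(A^{-1}(\sigma-\tau),r-\rho\bigr)+\bigl(c(u-w),z-v\bigr)+\bigl(\tau+A\nabla w+f_2,A^{-1}(r-\rho)\bigr)+\bigl(A^{-1}(\sigma-\tau),\rho+g_2+A\nabla v+bv\bigr).$$ Equivalently, $$\gamma-\gamma_1(w,\tau,v,\rho)=-\bigl(A^{-1}(\sigma-\tau),r-\rho\bigr)+\bigl(c(u-w),z-v\bigr)-\bigl(\nabla(u-w),r-\rho\bigr)-\bigl(\sigma-\tau,\nabla(z-v)+A^{-1}b(z-v)\bigr).$$ Consequently, $$|\gamma-\gamma_1(w,\tau,v,\rho)|\le C\bigl(\|\sigma-\tau\|_0+\|u-w\|_1\bigr)\bigl(\|r-\rho\|_0+\|z-v\|_1\bigr),$$ with $C$ depending only on $a_0^{-1}$, $\|b\|_{L^\infty(\Omega)}$ and $\|c\|_{L^\infty(\Omega)}$.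
   Context: Domain and coefficients: $\Omega\subset\mathbb R^d$, $d\ge2$, is a bounded Lipschitz domain with outward unit normal $n$ and $\partial\Omega=\overline{\Gamma_D}\cup\overline{\Gamma_N}$, where $\Gamma_D,\Gamma_N$ are disjoint relatively open subsets of $\partial\Omega$ and $|\Gamma_D|>0$. $A\in L^\infty(\Omega;\mathbb R^{d\times d})$ is symmetric with $a_0|\xi|^2\le\xi^TA(x)\xi\le a_1|\xi|^2$ for all $\xi\in\mathbb R^d$ and a.e. $x$, where $0<a_0\le a_1<\infty$; $b\in L^\infty(\Omega)^d$, $c\in L^\infty(\Omega)$. Data: $f_1,g_1\in L^2(\Omega)$, $f_2,g_2\in L^2(\Omega)^d$, $\psi_p,\psi_d\in L^2(\Gamma_N)$, $\phi_p,\phi_d\in H^{1/2}(\Gamma_D)$ (restrictions to $\Gamma_D$ of $H^{1/2}(\partial\Omega)$ functions). Notation: $(\cdot,\cdot)$ and $\|\cdot\|_0$ are the $L^2(\Omega)$ inner product and norm, $\|\cdot\|_1$ is the $H^1(\Omega)$ norm, $\langle\cdot,\cdot\rangle_{\Gamma_N}$ is the $L^2(\Gamma_N)$ pairing of traces. $H_D^1(\Omega)=\{v\in H^1(\Omega):v=0\text{ on }\Gamma_D\}$, $X_p=\{w\in H^1(\Omega):w=\phi_p\text{ on }\Gamma_D\}$, $X_d=\{v\in H^1(\Omega):v=\phi_d\text{ on }\Gamma_D\}$. For $t,s,w\in H^1(\Omega)$, $a(t,s)=(A\nabla t,\nabla s)+(b\cdot\nabla t+ct,s)$, $\ell(s)=(f_1,s)-(f_2,\nabla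 s)-\langle\psi_p,s\rangle_{\Gamma_N}$, $m(w)=(g_1,w)-(g_2,\nabla w)-\langle\psi_d,w\rangle_{\Gamma_N}$. Standing assumption (inf-sup): there is $\beta>0$ with $\beta=\inf_{0\ne w_0\in H_D^1(\Omega)}\sup_{0\ne v_0\in H_D^1(\Omega)}\frac{a(w_0,v_0)}{\|w_0\|_1\|v_0\|_1}=\inf_{0\ne v_0\in H_D^1(\Omega)}\sup_{0\ne w_0\in H_D^1(\Omega)}\frac{a(w_0,v_0)}{\|w_0\|_1\|v_0\|_1}$. Primal weak problem: find $u\in X_p$ with $a(u,s_0)=\ell(s_0)$ for all $s_0\in H_D^1(\Omega)$. Adjoint weak problem: find $z\in X_d$ with $a(s_0,z)=m(s_0)$ for all $s_0\in H_D^1(\Omega)$. Quantity of interest: with $\sigma=-A\nabla u-f_2\in H(\mathrm{div};\Omega)$ (so $\nabla\cdot\sigma=f_1-b\cdot\nabla u-cu$), $\mathcal J_p(u)=(g_1,u)-(g_2,\nabla u)-\langle\psi_d,u\rangle_{\Gamma_N}-\langle(A\nabla u+f_2)\cdot n,\phi_d\rangle_{\Gamma_D}$, where the last term equals $\langle\sigma\cdot n,\phi_d\rangle_{\Gamma_D}:=(\sigma,\nabla z_d)+(\nabla\cdot\sigma,z_d)-\langle\psi_p,z_d\rangle_{\Gamma_N}$ for any $z_d\in H^1(\Omega)$ with $z_d=\phi_d$ on $\Gamma_D$ (independent of the choice of $z_d$). Corrected quantity: for $w,v\in H^1(\Omega)$, $\tau,\rho\in L^2(\Omega)^d$ set $\widetilde\ell(\rho,v)=(f_1,v)+(f_2,A^{-1}(\rho+bv+g_2))-\langle\psi_p,v\rangle_{\Gamma_N}$,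 $\widetilde m(\tau,w)=(g_1,w)+(A^{-1}(\tau+f_2),g_2)-\langle\psi_d,w\rangle_{\Gamma_N}$, $\widetilde a((\tau,w),(\rho,v))=(A^{-1}(\tau+f_2),\rho+g_2)+(cw,v)$, $\widetilde\gamma_1(w,\tau,v,\rho)=\widetilde m(\tau,w)+\widetilde\ell(\rho,v)-\widetilde a((\tau,w),(\rho,v))$, and $\gamma_1(w,\tau,v,\rho)=\widetilde\gamma_1(w,\tau,v,\rho)+(\tau+A\nabla w+f_2,A^{-1}\rho)+(A^{-1}\tau,\rho+g_2+A\nabla v+bv)$. *)

(* Defs.v *)
From HB Require Import structures.
From mathcomp Require Import all_boot all_order all_algebra.
From mathcomp Require Import all_classical all_reals all_analysis.
From mathcomp Require Import measurable_realfun ess_sup_inf.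
Set Implicit Arguments. Unset Strict Implicit. Unset Printing Implicit Defensive.
Import Order.TTheory GRing.Theory Num.Theory.
Import numFieldNormedType.Exports.
Local Open Scope classical_set_scope.
Local Open Scope ring_scope.

Fact rV_display : measure_display. Proof. exact: default_measure_display. Qed.

(* Borel sigma-algebra of R^n, points being row vectors. *)
HB.instance Definition _ (R : realType) (n : nat) :=
  @isMeasurable.Build rV_display 'rV[R]_n <<s open >>
    (@sigma_algebra0 _ setT open) (@sigma_algebraC _ open)
    (@sigma_algebra_bigcup _ setT open).

Section borel.
Context {R : realType}.

Lemma open_measurable_rV n (U : set 'rV[R]_n) : open U -> measurable U.
Proof. exact: sub_sigma_algebra. Qed.

Lemma continuous_measurable_rV m n (f : 'rV[R]_m -> 'rV[R]_n) :
  continuous f -> measurable_fun [set: 'rV[R]_m] f.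
Proof.
move=> /continuousP cf.
refine (@measurability _ _ _ _ _ f (@open 'rV[R]_n) _ _) => //.
move=> _ [U oU <-]; rewrite setTI; apply: open_measurable_rV; exact: cf.
Qed.

Lemma continuous_measurable_rVR m (f : 'rV[R]_m -> R) :
  continuous f -> measurable_fun [set: 'rV[R]_m] f.
Proof.
move=> /continuousP cf; apply: (measurability _ (RGenOpens.measurableE R)).
move=> _ [_ [a [b ->] <-]]; rewrite setTI.
apply: open_measurable_rV; apply: cf; exact: interval_open.
Qed.

Definition rat_ball n (i : 'rV[rat]_n * nat) : set 'rV[R]_n :=
  ball (map_mx ratr i.1 : 'rV[R]_n) i.2.+1%:R^-1.

Lemma open_bigcup_rat_ball n (U : set 'rV[R]_n) : open U ->
  U = \bigcup_i (if `[< rat_ball i `<=` U >] then rat_ball i else set0).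
Proof.
rewrite openE => oU; apply/seteqP; split => [x Ux|x [i _]]; last first.
  by case: asboolP => // + bx; apply.
have /nbhs_ballP[e /= e0 xeU] := oU _ Ux.
have [k ke] : exists k, (2 / k.+1%:R : R) < e.
  have e2 : 0 < e / 2 by rewrite divr_gt0.
  have [k _ /(_ k (leqnn _))] := near_infty_natSinv_lt (PosNum e2).
  by move=> /= ke; exists k; rewrite mulrC -ltr_pdivlMr.
have k0 : (0 : R) < k.+1%:R^-1 by rewrite invr_gt0 ltr0n.
have /choice[q qx] : forall j, exists q, ball (x 0 j) k.+1%:R^-1 (ratr q : R).
  move=> j; have /rat_in_itvoo[q] : x 0 j - k.+1%:R^-1 < x 0 j + k.+1%:R^-1.
    by rewrite ltrD2l -subr_gt0 opprK addr_gt0.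
  by rewrite in_itv/= => q1; exists q; rewrite /ball/= ltr_distlC.
pose c : 'rV[rat]_n := \row_j q j.
exists (c, k) => //; case: asboolP => [_|[]].
  by split => // i j; rewrite ord1 !mxE; exact/ball_sym/qx.
move=> y [_ cy]; apply: xeU; split => // i j; rewrite ord1.
apply: (@le_ball _ _ _ (k.+1%:R^-1 + k.+1%:R^-1)).
  by rewrite -mulr2n -[leLHS]mulr_natl; exact: ltW.
by apply: ball_triangle (qx j) _; have := cy 0 j; rewrite !mxE.
Qed.

Definition cons_rV n (p : R * 'rV[R]_n) : 'rV[R]_n.+1 :=
  \row_j oapp (p.2 0) p.1 (unlift 0 j).

Definition uncons_rV n (v : 'rV[R]_n.+1) : R * 'rV[R]_n :=
  (v 0 0, \row_j v 0 (lift 0 j)).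

Lemma cons_rVK n : cancel (@cons_rV n) (@uncons_rV n).
Proof.
move=> [x v]; rewrite /uncons_rV mxE unlift_none/=; congr pair.
by apply/rowP => j; rewrite !mxE liftK.
Qed.

Lemma measurable_cons_rV n : measurable_fun setT (@cons_rV n).
Proof.
refine (@measurability _ _ _ _ _ _ (@open 'rV[R]_n.+1) _ _) => //.
move=> _ [U oU <-]; rewrite setTI.
rewrite (open_bigcup_rat_ball oU) preimage_bigcup.
apply: countable_bigcupT_measurable => // i.
case: ifPn => _; last by rewrite preimage_set0.
rewrite (_ : _ @^-1` _ = ball (ratr (i.1 0 0) : R) i.2.+1%:R^-1 `*`
    ball (\row_j ratr (i.1 0 (lift 0 j)) : 'rV[R]_n) i.2.+1%:R^-1).
  apply: measurableX; first exact: measurable_ball.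
  by apply: open_measurable_rV; apply: ball_open; rewrite invr_gt0 ltr0n.
apply/seteqP; split => -[x v]/=.
  move=> [i0 bx]; split => /=.
    by have := bx 0 0; rewrite !mxE unlift_none.
  split => // k j; rewrite ord1 !mxE.
  by have := bx 0 (lift 0 j); rewrite !mxE liftK.
move=> [bx [i0 bv]]; split => // k j; rewrite ord1 !mxE.
case: unliftP => [l ->|->]//=.
by have := bv 0 l; rewrite !mxE.
Qed.

Lemma measurable_uncons_rV n : measurable_fun setT (@uncons_rV n).
Proof.
apply: measurable_fun_pair.
  by apply: continuous_measurable_rVR; exact: coord_continuous.
apply: continuous_measurable_rV => v A /nbhs_ballP[e /= e0 eA].
apply/nbhs_ballP; exists e => //= w [_ vw]; apply: eA; split => // i j.
by rewrite !mxE.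
Qed.

Section lebesgue_cons.
Local Open Scope ereal_scope.
Variables (n : nat) (mu : {sigma_finite_measure set 'rV[R]_n -> \bar R}).

Definition lebesgue_cons : set 'rV[R]_n.+1 -> \bar R :=
  pushforward (@lebesgue_measure R \x mu) (@cons_rV n).

Let lebesgue_cons0 : lebesgue_cons set0 = 0.
Proof. by rewrite /lebesgue_cons/pushforward preimage_set0 measure0. Qed.

Let lebesgue_cons_ge0 A : 0 <= lebesgue_cons A.
Proof. by apply: integral_ge0 => x _; exact: measure_ge0. Qed.

Let lebesgue_cons_sigma_additive : semi_sigma_additive lebesgue_cons.
Proof.
have mf := @measurable_cons_rV n.
move=> F mF tF mUF; rewrite /lebesgue_cons/pushforward preimage_bigcup.
apply: measure_semi_sigma_additive.
- by move=> k; rewrite -[X in measurable X]setTI; exact: mf.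
- apply/trivIsetP => /= i j _ _ ij; rewrite -preimage_setI.
  by move/trivIsetP : tF => /(_ _ _ _ _ ij) ->//; rewrite preimage_set0.
- by rewrite -preimage_bigcup -[X in measurable X]setTI; exact: mf.
Qed.

HB.instance Definition _ := isMeasure.Build _ _ _ lebesgue_cons
  lebesgue_cons0 lebesgue_cons_ge0 lebesgue_cons_sigma_additive.

Let lebesgue_cons_sigma_finite : sigma_finite setT lebesgue_cons.
Proof.
have /sigma_finiteP[F [TF ndF Foo]] := sigma_finiteT (@lebesgue_measure R).
have /sigma_finiteP[G [TG ndG Goo]] := sigma_finiteT mu.
exists (fun k => @uncons_rV n @^-1` (F k `*` G k)).
  rewrite -preimage_bigcup (_ : \bigcup_k _ = setT) ?preimage_setT//.
  apply/seteqP; split => // -[x y] _.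
  have [k _ Fkx] : (\bigcup_k F k) x by rewrite -TF.
  have [l _ Gly] : (\bigcup_k G k) y by rewrite -TG.
  exists (maxn k l) => //; split.
  - by move: x Fkx; exact/subsetPset/ndF/leq_maxl.
  - by move: y Gly; exact/subsetPset/ndG/leq_maxr.
move=> k; have [mF Fk] := Foo k; have [mG Gk] := Goo k; split.
  rewrite -[X in measurable X]setTI; apply: measurable_uncons_rV => //.
  exact: measurableX.
rewrite /lebesgue_cons/pushforward -comp_preimage.
rewrite (_ : _ \o _ = id); last by apply/funext => p /=; rewrite cons_rVK.
by rewrite product_measure1E// lte_mul_pinfty// ge0_fin_numE.
Qed.

HB.instance Definition _ := Measure_isSigmaFinite.Build _ _ _ lebesgue_cons
  lebesgue_cons_sigma_finite.

End lebesgue_cons.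

(* Lebesgue measure on R^n as the iterated product of the one-dimensional
   one, along cons_rV : R * R^m -> R^(m+1). *)
Fixpoint lebesgue_rV n : {sigma_finite_measure set 'rV[R]_n -> \bar R} :=
  match n with
  | 0 => \d_(0 : 'rV[R]_0)
  | m.+1 => lebesgue_cons (lebesgue_rV m)
  end.

End borel.

Section euclidean.
Context {R : realType} {n : nat}.
Implicit Types (u v : 'rV[R]_n) (U : set 'rV[R]_n).

Definition dotv u v : R := \sum_(i < n) u 0 i * v 0 i.

(* The library norm on 'rV[R]_n is the sup norm; lengths, diameters and the
   Hausdorff measure below need the Euclidean one. *)
Definition enorm v : R := Num.sqrt (dotv v v).

Definition ediam U : \bar R :=
  ereal_sup [set (enorm (p.1 - p.2))%:E | p in U `*` U].

Lemma enorm_ge_coord v i : `|v 0 i| <= enorm v.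
Proof.
rewrite -sqrtr_sqr ler_sqrt; last by apply: sumr_ge0 => j _; rewrite -expr2 sqr_ge0.
rewrite /dotv (bigD1 i)//= -expr2 lerDl; apply: sumr_ge0 => j _.
by rewrite -expr2 sqr_ge0.
Qed.

Lemma ediam_ge0 U : U !=set0 -> (0 <= ediam U)%E.
Proof.
move=> [x Ux]; apply: ereal_sup_ubound; exists (x, x) => //=; congr (_%:E).
rewrite subrr /enorm /dotv big1 ?sqrtr0// => i _.
by rewrite !mxE mul0r.
Qed.

End euclidean.

Section hausdorff.
Context {R : realType} {n : nat}.
Local Open Scope ereal_scope.
Implicit Types (A U : set 'rV[R]_n) (F : (set 'rV[R]_n)^nat) (s : nat).

(* Normalised s-dimensional Hausdorff measure: with the factor omega_s / 2^s,
   omega_s the volume of the unit ball of R^s, it is the surface area on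
   s-dimensional Lipschitz surfaces. *)
Definition hausdorff_cst s : R :=
  (fine (lebesgue_rV s [set x : 'rV[R]_s | enorm x <= 1]) / 2 ^+ s)%R.

Definition hausdorff_cost s U : \bar R :=
  if `[< U = set0 >] then 0 else (hausdorff_cst s)%:E * ediam U ^+ s.

Definition hausdorff_pre s (delta : R) A : \bar R :=
  ereal_inf [set \sum_(k <oo) hausdorff_cost s (F k) | F in
    [set F | A `<=` \bigcup_k F k /\ forall k, ediam (F k) <= delta%:E]].

Definition hausdorff s A : \bar R :=
  ereal_sup [set hausdorff_pre s delta A | delta in [set e : R | (0 < e)%R]].

Lemma hausdorff_cost0 s : hausdorff_cost s set0 = 0.
Proof. by rewrite /hausdorff_cost; case: asboolP. Qed.

Lemma hausdorff_cost_ge0 s U : 0 <= hausdorff_cost s U.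
Proof.
rewrite /hausdorff_cost; case: asboolP => // /eqP/set0P U0.
apply: mule_ge0; last by rewrite expe_ge0// ediam_ge0.
by rewrite lee_fin divr_ge0// ?fine_ge0// exprn_ge0.
Qed.

Let cost s (delta : R)
    (U : set (g_sigma_algebraType [set: set 'rV[R]_n])) : \bar R :=
  if ediam (U : set 'rV[R]_n) <= delta%:E then hausdorff_cost s U else +oo.

Let ediam0 : ediam (set0 : set 'rV[R]_n) = -oo.
Proof. by rewrite /ediam set0X image_set0 ereal_sup0. Qed.

Let cost_ge0 s delta U : 0 <= cost s delta U.
Proof. by rewrite /cost; case: ifPn => // _; exact: hausdorff_cost_ge0. Qed.

Let cost0 s delta : cost s delta set0 = 0.
Proof. by rewrite /cost ediam0 leNye hausdorff_cost0. Qed.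

Lemma hausdorff_preE s delta A :
  hausdorff_pre s delta A = mu_ext (cost s delta) A.
Proof.
apply/eqP; rewrite eq_le; apply/andP; split.
  apply: le_ereal_inf_tmp => _ [F [mF AF] <-].
  have [Fd|] := pselect (forall k, ediam (F k : set 'rV[R]_n) <= delta%:E).
    apply: ereal_inf_lbound; exists F => //.
    by apply: eq_eseriesr => k _; rewrite /cost Fd.
  move=> /existsNP[k /negP Fk].
  rewrite (@eseries_pinfty _ _ _ k) ?leey// /cost ?(negbTE Fk)// => i _.
  by rewrite -ltNye (lt_le_trans _ (cost_ge0 s delta _)).
apply: le_ereal_inf_tmp => _ [F [AF Fd] <-].
apply: ereal_inf_lbound; exists F; first by split => // i; exact: sub_sigma_algebra.
by apply: eq_eseriesr => k _; rewrite /cost Fd.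
Qed.

Let pre0 s delta : hausdorff_pre s delta set0 = 0.
Proof. by rewrite hausdorff_preE mu_ext0. Qed.

Let pre_ge0 s delta A : 0 <= hausdorff_pre s delta A.
Proof. by rewrite hausdorff_preE; apply: mu_ext_ge0. Qed.

Let le_pre s delta A B : A `<=` B ->
  hausdorff_pre s delta A <= hausdorff_pre s delta B.
Proof. by move=> AB; rewrite !hausdorff_preE; apply: le_mu_ext. Qed.

Let pre_subadditive s delta : sigma_subadditive (hausdorff_pre s delta).
Proof.
move=> F; rewrite hausdorff_preE.
under eq_eseriesr do rewrite hausdorff_preE.
exact: (@mu_ext_sigma_subadditive _ _ _ (cost s delta) (cost_ge0 s delta)).
Qed.

Let le_pre_delta s d1 d2 A : (d1 <= d2)%R ->
  hausdorff_pre s d2 A <= hausdorff_pre s d1 A.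
Proof.
move=> d12; apply: ereal_inf_le_tmp => _ [F [AF Fd] <-]; exists F => //; split => //.
by move=> k; rewrite (le_trans (Fd k))// lee_fin.
Qed.

Let pre_le s delta A : (0 < delta)%R -> hausdorff_pre s delta A <= hausdorff s A.
Proof. by move=> d0; apply: ereal_sup_ubound; exists delta. Qed.

Let hausdorff0 s : hausdorff s set0 = 0.
Proof.
apply/eqP; rewrite eq_le; apply/andP; split.
  by apply: ge_ereal_sup => _ [e /= e0 <-]; rewrite pre0.
by rewrite -(pre0 s 1); exact: pre_le.
Qed.

Let hausdorff_ge0 s A : 0 <= hausdorff s A.
Proof. exact: (le_trans (pre_ge0 s 1 A) (pre_le _ _ _)). Qed.

Let le_hausdorff s : {homo hausdorff s : A B / A `<=` B >-> A <= B}.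
Proof.
move=> A B AB; apply: ge_ereal_sup => _ [e /= e0 <-].
exact: (le_trans (le_pre s e AB) (pre_le _ _ e0)).
Qed.

Let hausdorff_subadditive s : sigma_subadditive (hausdorff s).
Proof.
move=> F; apply: ge_ereal_sup => _ [e /= e0 <-].
apply: (le_trans (pre_subadditive s e F)).
by apply: lee_nneseries => [k _ _|k _]; [exact: pre_ge0|exact: pre_le].
Qed.

HB.instance Definition _ s := isOuterMeasure.Build R 'rV[R]_n (hausdorff s)
  (hausdorff0 s) (hausdorff_ge0 s) (@le_hausdorff s) (hausdorff_subadditive s).


Let pre_sep s (f : 'rV[R]_n -> R) P Q a b delta :
  (forall x y, f x - f y <= enorm (x - y))%R ->
  (forall x, P x -> f x <= a)%R -> (forall x, Q x -> b <= f x)%R ->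
  (delta < b - a)%R ->
  hausdorff_pre s delta P + hausdorff_pre s delta Q <=
  hausdorff_pre s delta (P `|` Q).
Proof.
move=> flip Pa Qb dab; apply: le_ereal_inf_tmp => _ [F [PQF Fd] <-].
pose FI (S : set 'rV[R]_n) k := if `[< F k `&` S !=set0 >] then F k else set0.
have FI_le S : S `<=` P `|` Q ->
    hausdorff_pre s delta S <= \sum_(k <oo) hausdorff_cost s (FI S k).
  move=> SPQ; apply: ereal_inf_lbound; exists (FI S) => //; split.
    move=> x Sx; have [k _ Fkx] := PQF _ (SPQ _ Sx); exists k => //.
    by rewrite /FI; case: asboolP => // -[]; exists x.
  by move=> k; rewrite /FI; case: ifPn => // _; rewrite ediam0 leNye.
apply: (le_trans (leeD (FI_le P _) (FI_le Q _))).
- by move=> x; left.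
- by move=> x; right.
rewrite -nneseriesD; [|by move=> *; exact: hausdorff_cost_ge0..].
apply: lee_nneseries => [k _ _|k _].
  by rewrite adde_ge0 ?hausdorff_cost_ge0.
rewrite /FI; case: asboolP => [[x [Fx Px]]|_]; last first.
  rewrite hausdorff_cost0 add0e.
  by case: ifPn => // _; rewrite hausdorff_cost0 hausdorff_cost_ge0.
case: asboolP => [[y [Fy Qy]]|_]; last by rewrite hausdorff_cost0 adde0.
exfalso; have : ((b - a)%:E <= delta%:E)%E.
  apply: le_trans (Fd k); apply: (@le_trans _ _ (enorm (y - x))%:E).
    by rewrite lee_fin (le_trans _ (flip y x))// lerB ?Qb ?Pa.
  by apply: ereal_sup_ubound; exists (y, x).
by rewrite lee_fin leNgt dab.
Qed.

Let hausdorff_sep s (f : 'rV[R]_n -> R) P Q a b :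
  (forall x y, f x - f y <= enorm (x - y))%R ->
  (forall x, P x -> f x <= a)%R -> (forall x, Q x -> b <= f x)%R ->
  (a < b)%R ->
  hausdorff s P + hausdorff s Q <= hausdorff s (P `|` Q).
Proof.
move=> flip Pa Qb ab; set M := hausdorff s (P `|` Q).
have PM : hausdorff s P <= M by apply: le_hausdorff => x; left.
have QM : hausdorff s Q <= M by apply: le_hausdorff => x; right.
have preM d1 d2 : (0 < d1)%R -> (0 < d2)%R ->
    hausdorff_pre s d1 P + hausdorff_pre s d2 Q <= M.
  move=> d10 d20; pose d := Num.min (Num.min d1 d2) ((b - a) / 2)%R.
  have ba0 : (0 < b - a)%R by rewrite subr_gt0.
  have d0 : (0 < d)%R by rewrite !lt_min d10 d20 divr_gt0.
  apply: le_trans (pre_le s (P `|` Q) d0).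
  apply: le_trans (pre_sep s flip Pa Qb _); last first.
    rewrite (@le_lt_trans _ _ ((b - a) / 2)%R)// ?ge_min ?lexx ?orbT//.
    by rewrite ltr_pdivrMr// ltr_pMr// ltr1n.
  by apply: leeD; apply: le_pre_delta; rewrite !ge_min lexx ?orbT.
have [->|Moo] := eqVneq M +oo; first by rewrite leey.
have fin x : 0 <= x -> x <= M -> x \is a fin_num.
  by move=> x0 xM; rewrite ge0_fin_numE// (le_lt_trans xM)// ltey.
have Qfin := fin _ (hausdorff_ge0 s Q) QM.
rewrite -leeBrDr//; apply: ge_ereal_sup => _ [d1 /= d10 <-].
rewrite leeBrDr// addeC -leeBrDr; last first.
  by apply: fin => //; exact: (le_trans (pre_le s P d10)).
apply: ge_ereal_sup => _ [d2 /= d20 <-].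
rewrite leeBrDr 1?addeC ?preM//.
by apply: fin => //; exact: (le_trans (pre_le s P d10)).
Qed.

(* Sublevel sets of functions that are 1-Lipschitz for the Euclidean distance
   are Caratheodory-measurable, by Caratheodory's metric criterion. *)
Let caratheodory_sublevel s (f : 'rV[R]_n -> R) :
  (forall x y, f x - f y <= enorm (x - y))%R ->
  (hausdorff s).-caratheodory [set x | (f x <= 0)%R].
Proof.
move=> flip; apply: le_caratheodory_measurable => X.
set A := [set x | _]; pose M := hausdorff s X.
change (hausdorff s (X `&` A) + hausdorff s (X `&` ~` A) <= M).
have [->|Moo] := eqVneq M +oo; first by rewrite leey.
pose w k : R := (k.+1%:R^-1)%R.
have w_gt0 k : (0 < w k)%R by rewrite invr_gt0 ltr0n.
have w_lt k l : (k < l)%N -> (w l < w k)%R.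
  by move=> kl; rewrite ltf_pV2 ?posrE ?ltr0n// ltr_nat.
pose Y k := X `&` [set x | (w k < f x)%R].
pose S k := X `&` [set x | (w k.+2 < f x <= w k.+1)%R].
have YX k : Y k `<=` X by move=> x [].
have sumS o m : \sum_(0 <= k < m) hausdorff s (S (k.*2 + o)%N) <=
    hausdorff s (Y (m.*2 + o)%N).
  elim: m => [|m IH]; first by rewrite big_geq.
  rewrite big_nat_recr//= addeC; apply: (le_trans (leeD (lexx _) IH)).
  have sep := @hausdorff_sep s f (S (m.*2 + o)%N) (Y (m.*2 + o)%N)
    (w (m.*2 + o).+1) (w (m.*2 + o)%N) flip.
  apply: (le_trans (sep _ _ _)).
  - by move=> x [_ /= /andP[]].
  - by move=> x [_ /= /ltW].
  - exact: w_lt.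
  - apply: le_hausdorff => x [[Xx /= /andP[fx _]]|[Xx /= fx]]; split => //=.
    by rewrite (lt_trans _ fx)// doubleS !addSn w_lt.
have serS o : \sum_(k <oo) hausdorff s (S (k.*2 + o)%N) < +oo.
  apply: (@le_lt_trans _ _ M); last by rewrite ltey.
  apply: lime_le; first by apply: is_cvg_nneseries => *; exact: hausdorff_ge0.
  apply: nearW => m; apply: (le_trans (sumS o m)).
  exact/le_hausdorff/YX.
pose T o N := \sum_(N <= k <oo) hausdorff s (S (k.*2 + o)%N).
have cvgT : (fun N => M + (T 0%N N + T 1%N N)) @ \oo --> M.
  rewrite -[X in _ --> X]adde0 -[X in _ --> _ + X]adde0.
  apply: cvgeD; [by rewrite adde0; exact: fin_num_adde_defl|exact: cvg_cst|].
  by apply: cvgeD => //; apply: nneseries_tail_cvg => // k _; exact: hausdorff_ge0.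
suff leN N : hausdorff s (X `&` A) + hausdorff s (X `&` ~` A) <=
    M + (T 0%N N + T 1%N N).
  have /cvg_lim <- := cvgT; last by [].
  apply: lime_ge; first by apply/cvg_ex; exists M.
  exact: nearW.
have XAY : hausdorff s (X `&` A) + hausdorff s (Y N.*2.+1) <= M.
  have sep := @hausdorff_sep s f (X `&` A) (Y N.*2.+1) 0%R (w N.*2.+1) flip.
  apply: (le_trans (sep _ _ _)) => //.
  - by move=> x [].
  - by move=> x [_ /= /ltW].
  - by apply: le_hausdorff => x [[]|[]].
have XnA : hausdorff s (X `&` ~` A) <=
    hausdorff s (Y N.*2.+1) + (T 0%N N + T 1%N N).
  pose B o := \bigcup_(k in ~` `I_N) S (k.*2 + o)%N.
  have BT o : hausdorff s (B o) <= T o N.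
    exact: outer_measure_sigma_subadditive_tail.
  apply: (@le_trans _ _ (hausdorff s (Y N.*2.+1 `|` (B 0%N `|` B 1%N)))).
    apply: le_hausdorff => x [Xx /negP]; rewrite -ltNge => fx0.
    have [fxN|fxN] := ltP (w N.*2.+1) (f x); first by left.
    right.
    have ex : exists m, (w m < f x)%R.
      have [m _ /(_ m (leqnn _)) wm] := near_infty_natSinv_lt (PosNum fx0).
      by exists m.
    case: (ex_minnP ex) => m wm mmin.
    have Nm : (N.*2.+1 < m)%N.
      rewrite ltnNge; apply/negP; rewrite leq_eqVlt => /predU1P[mN|/w_lt mN].
        by move: wm; rewrite mN ltNge fxN.
      by move: (lt_trans mN wm); rewrite ltNge fxN.
    case: m Nm wm mmin => [//|[//|m]] Nm wm mmin.
    have Sx : S m x.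
      split => //=; rewrite wm/= leNgt; apply/negP => /mmin.
      by rewrite ltnn.
    have mE : m = (m./2.*2 + odd m)%N by rewrite addnC odd_double_half.
    have Nm2 : (~` `I_N) m./2.
      by apply/negP; rewrite -leqNgt geq_half_double -ltnS -ltnS.
    case mo: (odd m) mE => mE; [right|left]; exists m./2 => //; by rewrite -mE.
  apply: (le_trans (outer_measureU2 _ _ _)); apply: leeD => //.
  by apply: (le_trans (outer_measureU2 _ _ _)); apply: leeD; exact: BT.
apply: (le_trans (leeD (lexx _) XnA)); rewrite addeA.
exact: leeD.
Qed.

Lemma borel_caratheodory s A : measurable A -> (hausdorff s).-caratheodory A.
Proof.
apply: smallest_sub.
  split.
  - exact: caratheodory_measurable_set0.
  - by move=> B mB; rewrite setTD; exact: caratheodory_measurable_setC.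
  - by move=> F mF; exact: caratheodory_measurable_bigcup.
move=> U oU; rewrite (open_bigcup_rat_ball oU).
suff mb i : (hausdorff s).-caratheodory (rat_ball i : set 'rV[R]_n).
  have := @countable_bigcupT_measurable _
    (caratheodory_type (hausdorff s : set 'rV[R]_n -> \bar R)) _
    (fun i => if `[< rat_ball i `<=` U >] then rat_ball i else set0).
  by apply => // i; case: ifPn => // _; exact: mb.
pose c : 'rV[R]_n := map_mx ratr i.1.
have le_norm v : (`|v| <= enorm v)%R.
  rewrite -[leLHS]/(mx_norm v).
  have [->|/mx_norm_neq0[j ->]] := eqVneq (mx_norm v) 0%R; first exact: sqrtr_ge0.
  by rewrite (ord1 j.1) enorm_ge_coord.
pose f x : R := (i.2.+1%:R^-1 - `|c - x|)%R.
rewrite (_ : rat_ball i = ~` [set x | (f x <= 0)%R]).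
  apply: caratheodory_measurable_setC; apply: caratheodory_sublevel => x y.
  rewrite /f opprB addrC subrKA.
  apply: (@le_trans _ _ `|x - y|%R); last exact: le_norm.
  rewrite lerBlDr (_ : c - y = (x - y) + (c - x))%R ?ler_normD//.
  by rewrite [RHS]addrC subrKA.
apply/seteqP; split => x; rewrite /rat_ball -/c mx_norm_ball /ball_/= /f subr_le0.
  by rewrite ltNge => /negP.
by move=> /negP; rewrite -ltNge.
Qed.

Let hausdorff_sigma_additive s : semi_sigma_additive (hausdorff s).
Proof.
move=> F mF tF mUF.
by apply: (@caratheodory_measure_sigma_additive _ _ (hausdorff s)) => // [k|];
  exact: borel_caratheodory.
Qed.

HB.instance Definition _ s := isMeasure.Build _ 'rV[R]_n _ (hausdorff s)
  (hausdorff0 s) (hausdorff_ge0 s) (@hausdorff_sigma_additive s).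

End hausdorff.

Section square_integrable.
Context {R : realType} {dT} {T : measurableType dT}.
Variables (mu : {measure set T -> \bar R}) (D : set T).
Implicit Types f g : T -> R.

Definition ip f g : R := \int[mu]_(x in D) (f x * g x).

Definition norm0 f : R := Num.sqrt (ip f f).

Definition L2 f :=
  measurable_fun D f /\ mu.-integrable D (fun x => (f x ^+ 2)%:E).

Definition Linf f :=
  measurable_fun D f /\ exists M : R, {ae mu, forall x, D x -> `|f x| <= M}.

(* The zero extension does not affect the essential supremum of |f| on D. *)
Definition norm_inf f : R :=
  fine (ess_sup mu ((fun x => `|f x|%:E) \_ D)).

Context {d : nat}.
Implicit Types F G : T -> 'rV[R]_d.

Definition ipv F G : R := \int[mu]_(x in D) dotv (F x) (G x).

Definition norm0v F : R := Num.sqrt (ipv F F).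

Definition L2v F := forall i, L2 (fun x => F x 0 i).

Definition Linfv F := forall i, Linf (fun x => F x 0 i).

Definition norm_infv F : R := norm_inf (fun x => enorm (F x)).

End square_integrable.

Section sobolev.
Context {R : realType} {d : nat}.
Implicit Types (Omega : set 'rV[R]_d) (u f phi : 'rV[R]_d -> R)
  (F G : 'rV[R]_d -> 'rV[R]_d).

Definition partial (i : 'I_d) f : 'rV[R]_d -> R :=
  fun x => 'D_(delta_mx 0 i) f x.

Fixpoint Ck (k : nat) f : Prop :=
  continuous f /\
  if k is k'.+1 then
    forall i, (forall x, derivable f x (delta_mx 0 i)) /\ Ck k' (partial i f)
  else True.

Definition smooth f := forall k, Ck k f.

Definition test_function Omega phi := smooth phi /\
  exists K, [/\ compact K, K `<=` Omega & forall x, ~ K x -> phi x = 0].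

Definition weak_gradient Omega u G :=
  L2v (lebesgue_rV d) Omega G /\
  forall phi i, test_function Omega phi ->
    ip (lebesgue_rV d) Omega u (partial i phi) =
    - ip (lebesgue_rV d) Omega (fun x => G x 0 i) phi.

Definition H1 Omega u :=
  L2 (lebesgue_rV d) Omega u /\ exists G, weak_gradient Omega u G.

(* Weak gradients are unique up to null sets: grad selects a representative
   (and is 0 if there is none). *)
Definition grad Omega u : 'rV[R]_d -> 'rV[R]_d :=
  xget (fun=> 0) [set G | weak_gradient Omega u G].

Definition norm1 Omega u : R :=
  Num.sqrt (norm0 (lebesgue_rV d) Omega u ^+ 2 +
            norm0v (lebesgue_rV d) Omega (grad Omega u) ^+ 2).

Definition weak_divergence Omega F (q : 'rV[R]_d -> R) :=
  L2 (lebesgue_rV d) Omega q /\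
  forall phi, test_function Omega phi ->
    ipv (lebesgue_rV d) Omega F (fun x => \row_i partial i phi x) =
    - ip (lebesgue_rV d) Omega q phi.

Definition divergence Omega F : 'rV[R]_d -> R :=
  xget (fun=> 0) [set q | weak_divergence Omega F q].

End sobolev.

Section boundary.
Context {R : realType} {d : nat}.
Implicit Types (Omega Gamma : set 'rV[R]_d) (phi : 'rV[R]_d -> R).

Definition frontier Omega : set 'rV[R]_d := closure Omega `\` Omega°.

Definition surface : {measure set 'rV[R]_d -> \bar R} := hausdorff d.-1.

(* Near each boundary point p, Omega is the strict epigraph, in the direction
   of a unit vector e, of a Lipschitz function h of the component of x
   orthogonal to e. *)
Definition bounded_lipschitz_domain Omega :=
  [/\ open Omega, connected Omega, bounded_set Omega &
      forall p, frontier Omega p ->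
      exists (e : 'rV[R]_d) (h : 'rV[R]_d -> R),
        [/\ enorm e = 1, lipschitz h &
            \forall x \near p,
              Omega x <-> h (x - dotv x e *: e) < dotv x e]].

Definition boundary_partition Omega (GammaD GammaN : set 'rV[R]_d) :=
  [/\ exists2 U, open U & GammaD = U `&` frontier Omega,
      exists2 U, open U & GammaN = U `&` frontier Omega,
      GammaD `&` GammaN = set0,
      frontier Omega = closure GammaD `|` closure GammaN &
      (0 < surface GammaD)%E].

(* The trace operator of a Lipschitz domain is the bounded linear map from
   H^1(Omega) to L^2 of the boundary that restricts functions smooth up to the
   boundary; by density of the latter these clauses determine it up to
   surface-null sets. *)
Definition trace_operator Omega
    (tr : ('rV[R]_d -> R) -> 'rV[R]_d -> R) :=
  [/\ forall u, H1 Omega u -> L2 surface (frontier Omega) (tr u),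
      forall (k : R) u v, H1 Omega u -> H1 Omega v ->
        ae_eq surface (frontier Omega) (tr (fun x => k * u x + v x))
          (fun x => k * tr u x + tr v x),
      exists K : R, forall u, H1 Omega u ->
        norm0 surface (frontier Omega) (tr u) <= K * norm1 Omega u &
      forall phi, smooth phi ->
        ae_eq surface (frontier Omega) (tr phi) phi].

(* Sobolev-Slobodeckij norm on the (d-1)-dimensional boundary: the exponent of
   |x - y| is (d - 1) + 2 * (1 / 2) = d. *)
Definition Hhalf Omega phi :=
  L2 surface (frontier Omega) phi /\
  (\int[surface]_(x in frontier Omega) \int[surface]_(y in frontier Omega)
     ((phi x - phi y) ^+ 2 / enorm (x - y) ^+ d)%:E < +oo)%E.

Definition Hhalf_on Omega Gamma phi :=
  exists2 Phi, Hhalf Omega Phi & ae_eq surface Gamma phi Phi.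

End boundary.

Record problem (R : realType) (d : nat) := Problem {
  dom : set 'rV[R]_d ;
  GammaD : set 'rV[R]_d ;
  GammaN : set 'rV[R]_d ;
  coefA : 'rV[R]_d -> 'M[R]_d ;
  coefb : 'rV[R]_d -> 'rV[R]_d ;
  coefc : 'rV[R]_d -> R ;
  f1 : 'rV[R]_d -> R ;
  f2 : 'rV[R]_d -> 'rV[R]_d ;
  g1 : 'rV[R]_d -> R ;
  g2 : 'rV[R]_d -> 'rV[R]_d ;
  psip : 'rV[R]_d -> R ;
  psid : 'rV[R]_d -> R ;
  phip : 'rV[R]_d -> R ;
  phid : 'rV[R]_d -> R
}.

(* The product M v, v and M v being written as row vectors. *)
Definition mulmv {R : realType} {d} (M : 'M[R]_d) (v : 'rV[R]_d) : 'rV[R]_d :=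
  v *m M^T.

Section weak_problems.
Context {R : realType} {d : nat}.
Variables (P : problem R d) (tr : ('rV[R]_d -> R) -> 'rV[R]_d -> R).
Implicit Types (s t u v w z : 'rV[R]_d -> R) (tau rho : 'rV[R]_d -> 'rV[R]_d).

Local Notation Omega := (dom P).
Local Notation A := (coefA P).
Local Notation b := (coefb P).
Local Notation c := (coefc P).
Local Notation "\nabla u" := (grad Omega u) (at level 8, u at level 8).
Local Notation "<| f , g |>" := (ip (lebesgue_rV d) Omega f g).
Local Notation "<[ F , G ]>" := (ipv (lebesgue_rV d) Omega F G).
Local Notation pairN psi s := (ip surface (GammaN P) psi (tr s)).

Definition applyA tau : 'rV[R]_d -> 'rV[R]_d := fun x => mulmv (A x) (tau x).
Definition applyAinv tau : 'rV[R]_d -> 'rV[R]_d :=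
  fun x => mulmv (invmx (A x)) (tau x).
Definition scaleb v : 'rV[R]_d -> 'rV[R]_d := fun x => v x *: b x.

Definition admissible_coefficients (a0 a1 : R) :=
  [/\ 0 < a0 /\ a0 <= a1,
      forall i j, Linf (lebesgue_rV d) Omega (fun x => A x i j),
      {ae lebesgue_rV d, forall x, Omega x -> (A x)^T = A x /\
        forall xi, a0 * enorm xi ^+ 2 <= dotv xi (mulmv (A x) xi)
                   /\ dotv xi (mulmv (A x) xi) <= a1 * enorm xi ^+ 2},
      Linfv (lebesgue_rV d) Omega b &
      Linf (lebesgue_rV d) Omega c].

Definition admissible_data :=
  [/\ L2 (lebesgue_rV d) Omega (f1 P) /\ L2 (lebesgue_rV d) Omega (g1 P),
      L2v (lebesgue_rV d) Omega (f2 P) /\ L2v (lebesgue_rV d) Omega (g2 P),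
      L2 surface (GammaN P) (psip P) /\ L2 surface (GammaN P) (psid P) &
      Hhalf_on Omega (GammaD P) (phip P) /\
      Hhalf_on Omega (GammaD P) (phid P)].

Definition H1_with_value (phi : 'rV[R]_d -> R) u :=
  H1 Omega u /\ ae_eq surface (GammaD P) (tr u) phi.

Definition HD := H1_with_value (cst 0).
Definition Xp := H1_with_value (phip P).
Definition Xd := H1_with_value (phid P).

Definition aform t s : R :=
  <[applyA \nabla t, \nabla s]> +
  <|fun x => dotv (b x) (\nabla t x) + c x * t x, s|>.

Definition ell s : R :=
  <|f1 P, s|> - <[f2 P, \nabla s]> - pairN (psip P) s.

Definition emm w : R :=
  <|g1 P, w|> - <[g2 P, \nabla w]> - pairN (psid P) w.

(* Nonzero as an element of H^1, i.e. as a class modulo null sets. *)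
Definition HD_nonzero : set ('rV[R]_d -> R) :=
  [set v | HD v /\ ~ ae_eq (lebesgue_rV d) Omega v (cst 0)].

Definition quotient w v : \bar R :=
  (aform w v / (norm1 Omega w * norm1 Omega v))%:E.

Definition inf_sup (beta : R) :=
  beta%:E = ereal_inf [set ereal_sup [set quotient w v | v in HD_nonzero]
                      | w in HD_nonzero] /\
  beta%:E = ereal_inf [set ereal_sup [set quotient w v | w in HD_nonzero]
                      | v in HD_nonzero].

Definition primal_solution u :=
  Xp u /\ forall s, HD s -> aform u s = ell s.

Definition adjoint_solution z :=
  Xd z /\ forall s, HD s -> aform s z = emm s.

Definition flux u : 'rV[R]_d -> 'rV[R]_d := - applyA \nabla u - f2 P.

Definition adjoint_flux z : 'rV[R]_d -> 'rV[R]_d :=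
  - (applyA \nabla z + scaleb z + g2 P).

(* < tau . n , phi_d >_GammaD, for an extension zd of phi_d, when
   tau . n = psi_p on GammaN. *)
Definition normal_flux_pairing tau zd : R :=
  <[tau, \nabla zd]> + <|divergence Omega tau, zd|> - pairN (psip P) zd.

(* - (A grad u + f2) . n is the normal component of flux u. *)
Definition Jp u zd : R :=
  <|g1 P, u|> - <[g2 P, \nabla u]> - pairN (psid P) u
  + normal_flux_pairing (flux u) zd.

Definition ell_tilde rho v : R :=
  <|f1 P, v|> + <[f2 P, applyAinv (rho + scaleb v + g2 P)]> - pairN (psip P) v.

Definition emm_tilde tau w : R :=
  <|g1 P, w|> + <[applyAinv (tau + f2 P), g2 P]> - pairN (psid P) w.

Definition a_tilde tau w rho v : R :=
  <[applyAinv (tau + f2 P), rho + g2 P]> + <|c * w, v|>.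

Definition gamma1_tilde w tau v rho : R :=
  emm_tilde tau w + ell_tilde rho v - a_tilde tau w rho v.

Definition gamma1 w tau v rho : R :=
  gamma1_tilde w tau v rho
  + <[tau + applyA \nabla w + f2 P, applyAinv rho]>
  + <[applyAinv tau, rho + g2 P + applyA \nabla v + scaleb v]>.

End weak_problems.

(* Main.v *)
(* With e = u - w, eps = z - v, the traces of e and eps vanish on Gamma_D, so
   they are admissible in the weak problems: a(u, eps) = ell(eps) and
   a(e, z) = m(e).  Testing the primal problem with compactly supported
   functions gives div sigma = f1 - b . grad u - c u, and testing it with z - zd
   allows zd to be replaced by z in J_p.  After moving A and A^-1 across the
   inner product by symmetry, both error formulas are identities between
   bilinear expressions in grad u, grad w, A^-1 tau, A^-1 f2 on one side and
   A grad z, A grad v, b z, b v, g2, rho on the other; the bound is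
   Cauchy-Schwarz on each term of the second formula.

   Since grad and div are chosen representatives, linearity of grad and the
   formula for div sigma rest on uniqueness of weak derivatives, i.e. on the
   fundamental lemma of the calculus of variations.  The latter uses smooth
   bumps built from exp(-1/t), which converge to the indicator of any open set,
   and a Dynkin class argument.  That smooth functions are weakly
   differentiable is Fubini together with the fundamental theorem of calculus
   in one coordinate. *)
Require Import Defs.
From mathcomp Require Import all_boot all_order all_algebra.
From mathcomp Require Import all_classical all_reals all_analysis.
From mathcomp Require Import measurable_realfun ess_sup_inf ring lra.
Set Implicit Arguments. Unset Strict Implicit. Unset Printing Implicit Defensive.
Import Order.TTheory GRing.Theory Num.Theory.
Import numFieldNormedType.Exports.
Local Open Scope classical_set_scope.
Local Open Scope ring_scope.

(** Two kinds of relations hold only up to null sets: those involving A (symmetry, invertibility,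
    the bound on A^-1), and linearity of the chosen gradient, since [grad (u - w)] is merely a.e.
    equal to [grad u - grad w]. They therefore enter only as equalities or inequalities of
    integrals, at the price of measurability of both sides; this is why [invmx], whose values at
    singular matrices are conventional, is shown measurable. Once everything is an integral, the two
    error formulas are linear algebra over values of one bilinear form. To make terms match, A^-1 is
    kept on the left argument, A and b on the right one. In the sum of [gamma1] and the claimed
    error all terms with tau and rho then cancel, and the rest equals J_p by a(u, z - v) = ell(z -
    v) and a(u - w, z) = m(u - w). Smooth calculus is needed because a test function may be inserted
    in the primal problem only once it is known to lie in H^1, with its classical gradient as weak
    gradient. *)

Section L2_space.
Context {R : realType} {dT} {T : measurableType dT}.
Variables (mu : {measure set T -> \bar R}) (D : set T) (mD : measurable D).
Implicit Types f g h : T -> R.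

Lemma L2_le_ae f g : measurable_fun D f -> L2 mu D g ->
  {ae mu, forall x, D x -> `|f x| <= `|g x|} -> L2 mu D f.
Proof.
move=> mf [mg ig] fg; split => //; apply/integrableP; split.
  by apply/measurable_EFinP; exact: measurable_funX.
have /integrableP[_] := ig; apply: le_lt_trans.
apply: ae_ge0_le_integral => //.
- by apply: measurableT_comp => //; apply/measurable_EFinP; exact: measurable_funX.
- by apply: measurableT_comp => //; apply/measurable_EFinP; exact: measurable_funX.
- apply: filterS fg => x /[apply] fg /=.
  by rewrite lee_fin !normrX lerXn2r// nnegrE.
Qed.

Lemma L2_le f g : measurable_fun D f -> L2 mu D g ->
  (forall x, D x -> `|f x| <= `|g x|) -> L2 mu D f.
Proof. by move=> mf g2 fg; apply: (L2_le_ae mf g2); exact: aeW. Qed.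

Lemma L2_integrableM f g : L2 mu D f -> L2 mu D g ->
  mu.-integrable D (EFin \o (fun x => f x * g x)).
Proof.
move=> [mf f2] [mg g2].
apply: (@le_integrable _ _ _ _ _ mD _ (fun x => (f x ^+ 2)%:E + (g x ^+ 2)%:E)%E).
- by apply/measurable_EFinP; exact: measurable_funM.
- move=> x Dx /=; rewrite lee_fin normrM.
  have : 0 <= (`|f x| - `|g x|) ^+ 2 by exact: sqr_ge0.
  rewrite (ger0_norm (addr_ge0 (sqr_ge0 _) (sqr_ge0 _))).
  rewrite -(real_normK (num_real (f x))) -(real_normK (num_real (g x))).
  set a := `|f x|; set b := `|g x|.
  have : 0 <= a * b by apply: mulr_ge0; exact: normr_ge0.
  nra.
- exact: integrableD.
Qed.

Lemma L2Z (k : R) f : L2 mu D f -> L2 mu D (fun x => k * f x).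
Proof.
move=> [mf f2]; split; first exact: measurable_funM.
have := integrableZl mD (k ^+ 2) f2.
by apply: eq_integrable => // x _; rewrite -EFinM exprMn.
Qed.

Lemma L2D f g : L2 mu D f -> L2 mu D g -> L2 mu D (fun x => f x + g x).
Proof.
move=> f2 g2; split; first by apply: measurable_funD; [case: f2|case: g2].
have fg := L2_integrableM f2 g2.
have [mf if2] := f2; have [mg ig2] := g2.
have := integrableD mD (integrableD mD if2 ig2) (integrableZl mD 2 fg).
apply: eq_integrable => // x _ /=; rewrite -EFinM -!EFinD; congr (_%:E).
by rewrite sqrrD mulr_natl addrAC.
Qed.

Lemma L2N f : L2 mu D f -> L2 mu D (fun x => - f x).
Proof.
by move=> /(L2Z (-1)); congr (L2 _ _ _); apply/funext => x; rewrite mulN1r.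
Qed.

Lemma L2B f g : L2 mu D f -> L2 mu D g -> L2 mu D (fun x => f x - g x).
Proof. by move=> f2 /L2N; exact: L2D. Qed.

Lemma L2_sum n (f : 'I_n -> T -> R) : (forall i, L2 mu D (f i)) ->
  L2 mu D (fun x => \sum_i f i x).
Proof.
move=> f2; have f0 : L2 mu D (cst 0).
  split => //; under [X in integrable _ _ X]eq_fun do rewrite expr0n.
  exact: integrable0.
elim: n f f2 => [|n IH] f f2.
  by under eq_fun do rewrite big_ord0.
by under eq_fun do rewrite big_ord_recl; apply: L2D => //; exact: IH.
Qed.

Lemma LinfM_L2 h f : Linf mu D h -> L2 mu D f -> L2 mu D (fun x => h x * f x).
Proof.
move=> [mh [M hM]] f2.
apply: (@L2_le_ae _ (fun x => M * f x)); [|exact: L2Z|].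
  by apply: measurable_funM => //; case: f2.
apply: filterS hM => x /[apply] hM.
by rewrite !normrM ler_wpM2r// (le_trans hM)// ler_norm.
Qed.

Lemma ip_ae_eq f g f' g' : L2 mu D f -> L2 mu D g ->
  measurable_fun D f' -> measurable_fun D g' ->
  ae_eq mu D f f' -> ae_eq mu D g g' -> ip mu D f g = ip mu D f' g'.
Proof.
move=> [mf _] [mg _] mf' mg' ff' gg'; rewrite /ip /Rintegral; congr fine.
apply: ae_eq_integral => //.
- by apply/measurable_EFinP; exact: measurable_funM.
- by apply/measurable_EFinP; exact: measurable_funM.
- by apply: filterS2 ff' gg' => x fx gx Dx; rewrite fx// gx.
Qed.

Lemma ipC f g : ip mu D f g = ip mu D g f.
Proof. by apply: eq_Rintegral => x _; rewrite mulrC. Qed.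

Lemma ipDl f g h : L2 mu D f -> L2 mu D g -> L2 mu D h ->
  ip mu D (fun x => f x + g x) h = ip mu D f h + ip mu D g h.
Proof.
move=> f2 g2 h2; rewrite /ip -RintegralD//; [|exact: L2_integrableM..].
by apply: eq_Rintegral => x _; rewrite mulrDl.
Qed.

Lemma ipZl (k : R) f h : L2 mu D f -> L2 mu D h ->
  ip mu D (fun x => k * f x) h = k * ip mu D f h.
Proof.
move=> f2 h2; rewrite /ip -RintegralZl//; last exact: L2_integrableM.
by apply: eq_Rintegral => x _; rewrite mulrA.
Qed.

Lemma ipBl f g h : L2 mu D f -> L2 mu D g -> L2 mu D h ->
  ip mu D (fun x => f x - g x) h = ip mu D f h - ip mu D g h.
Proof.
move=> f2 g2 h2; rewrite /ip -RintegralB//; [|exact: L2_integrableM..].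
by apply: eq_Rintegral => x _; rewrite mulrBl.
Qed.

Lemma ipBr f g h : L2 mu D f -> L2 mu D g -> L2 mu D h ->
  ip mu D h (fun x => f x - g x) = ip mu D h f - ip mu D h g.
Proof. by move=> f2 g2 h2; rewrite ipC ipBl// !(ipC h). Qed.

Lemma ip_ge0 f : 0 <= ip mu D f f.
Proof. by apply: Rintegral_ge0 => x _; rewrite -expr2 sqr_ge0. Qed.

(* The quadratic polynomial t |-> (t f + g, t f + g) is nonnegative. *)
Lemma Cauchy_Schwarz f g : L2 mu D f -> L2 mu D g ->
  ip mu D f g <= norm0 mu D f * norm0 mu D g.
Proof.
move=> f2 g2; set A := ip mu D f f; set B := ip mu D f g; set C := ip mu D g g.
have pol t : 0 <= t ^+ 2 * A + t * B *+ 2 + C.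
  have := ip_ge0 (fun x => t * f x + g x).
  have tf2 := L2Z t f2; have tfg2 := L2D tf2 g2.
  rewrite ipDl// ipZl// (ipC f (fun x => _)) (ipC g (fun x => _)) !ipDl// !ipZl//.
  by rewrite (ipC g f) -/A -/B -/C; congr (_ <= _); ring.
have A0 : 0 <= A by exact: ip_ge0.
have C0 : 0 <= C by exact: ip_ge0.
rewrite /norm0 -sqrtrM//; apply: (le_trans (ler_norm _)); rewrite -sqrtr_sqr.
apply: ler_wsqrtr; rewrite -/A -/C.
have [A00|A00] := eqVneq A 0; last first.
  have Ap : 0 < A by rewrite lt_neqAle eq_sym A00.
  (* The polynomial is minimal at t = -B / A, where its value is (A C - B^2) / A. *)
  have := pol (- B / A).
  rewrite (_ : _ + C = (A * C - B ^+ 2) / A); last by field.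
  by rewrite pmulr_lge0 ?invr_gt0// subr_ge0.
rewrite A00 mul0r; have [->|B0] := eqVneq B 0; first by rewrite expr0n.
(* For A = 0 the polynomial is affine in t; at this point it equals -1, which excludes a nonzero
   B. *)
have := pol (- (C + 1) / (B *+ 2)); rewrite A00 mulr0 add0r.
rewrite (_ : _ + C = - 1); first by rewrite ler0N1.
by field.
Qed.

(** Domination by an integrable product makes [h] integrable, and Cauchy-Schwarz bounds the
    dominating integral. Every term of the error bound is an instance: [k] collects the bounds on
    the coefficients, [f] and [g] are two error components or their Euclidean lengths. *)
Lemma normr_Rintegral_le (k : R) f g h : 0 <= k -> measurable_fun D h ->
  L2 mu D f -> L2 mu D g ->
  {ae mu, forall x, D x -> `|h x| <= k * (`|f x| * `|g x|)} ->
  `|\int[mu]_(x in D) h x| <= k * (norm0 mu D f * norm0 mu D g).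
Proof.
move=> k0 mh f2 g2 hfg.
pose af x := `|f x|; pose ag x := `|g x|.
have abs2 u : L2 mu D u -> L2 mu D (fun x => `|u x|).
  move=> u2; apply: (L2_le _ u2); last by move=> x _; rewrite normr_id.
  by apply: measurableT_comp => //; case: u2.
have af2 : L2 mu D af by exact: abs2.
have ag2 : L2 mu D ag by exact: abs2.
have normE u : norm0 mu D (fun x => `|u x|) = norm0 mu D u.
  by congr Num.sqrt; apply: eq_Rintegral => x _; rewrite -normrM -expr2 ger0_norm ?sqr_ge0.
rewrite -(normE f) -(normE g).
have ifg := L2_integrableM (L2Z k af2) ag2.
have le_int : (\int[mu]_(x in D) `|(h x)%:E| <=
    \int[mu]_(x in D) (k * af x * ag x)%:E)%E.
  apply: ae_ge0_le_integral => //.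
  - by apply: measurableT_comp => //; exact/measurable_EFinP.
  - by move=> x _; rewrite lee_fin; apply: mulr_ge0; rewrite ?mulr_ge0 ?normr_ge0.
  - by have /integrableP[] := ifg.
  - by apply: filterS hfg => x /[apply]; rewrite lee_fin -mulrA.
have ih : mu.-integrable D (EFin \o h).
  apply/integrableP; split; first exact/measurable_EFinP.
  rewrite (le_lt_trans le_int)// ltey_eq; apply/orP; left.
  exact: (integrable_fin_num mD ifg).
apply: (le_trans (le_normr_Rintegral mD ih)).
apply: (@le_trans _ _ (ip mu D (fun x => k * af x) ag)).
  rewrite -lee_fin /Rintegral !fineK ?(integrable_fin_num mD)//.
  exact: integrable_norm ih.
by rewrite ipZl// ler_wpM2l//; exact: Cauchy_Schwarz.
Qed.

End L2_space.

(** * Euclidean vectors and coercive matrices *)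

Section euclidean_space.
Context {R : realType} {d : nat}.
Implicit Types (u v w : 'rV[R]_d) (M : 'M[R]_d).

Lemma dotvC u v : dotv u v = dotv v u.
Proof. by apply: eq_bigr => i _; rewrite mulrC. Qed.

Lemma dotvDl u v w : dotv (u + v) w = dotv u w + dotv v w.
Proof.
by rewrite /dotv -big_split/=; apply: eq_bigr => i _; rewrite mxE mulrDl.
Qed.

Lemma dotvZl (k : R) u v : dotv (k *: u) v = k * dotv u v.
Proof.
by rewrite /dotv mulr_sumr; apply: eq_bigr => i _; rewrite mxE mulrA.
Qed.

Lemma dotvNl u v : dotv (- u) v = - dotv u v.
Proof. by rewrite -scaleN1r dotvZl mulN1r. Qed.

Lemma dotvDr u v w : dotv u (v + w) = dotv u v + dotv u w.
Proof. by rewrite dotvC dotvDl !(dotvC u). Qed.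

Lemma dotvZr (k : R) u v : dotv u (k *: v) = k * dotv u v.
Proof. by rewrite dotvC dotvZl (dotvC u). Qed.

Lemma dotv_ge0 u : 0 <= dotv u u.
Proof. by apply: sumr_ge0 => i _; rewrite -expr2 sqr_ge0. Qed.

Lemma enorm_ge0 u : 0 <= enorm u.
Proof. exact: sqrtr_ge0. Qed.

Lemma enorm_sqr u : enorm u ^+ 2 = dotv u u.
Proof. by rewrite sqr_sqrtr// dotv_ge0. Qed.

(** The homogeneous inequality |t u + s v|^2 >= 0 avoids division: t = -B, s = A gives A (A C - B^2)
    >= 0. When A = 0, the choice t = -(C + 1), s = B gives -(C + 2) B^2 >= 0. *)
Lemma normr_dotv_le u v : `|dotv u v| <= enorm u * enorm v.
Proof.
have nn := mulr_ge0 (enorm_ge0 u) (enorm_ge0 v).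
have /ler_pXn2r <- // : (0 < 2)%N by []; rewrite ?nnegrE//.
rewrite real_normK ?num_real// exprMn !enorm_sqr.
set A := dotv u u; set B := dotv u v; set C := dotv v v.
have pol t s : 0 <= t ^+ 2 * A + t * s * B *+ 2 + s ^+ 2 * C.
  have := dotv_ge0 (t *: u + s *: v).
  rewrite !(dotvDl, dotvDr, dotvZl, dotvZr) (dotvC v u) -/A -/B -/C.
  by congr (_ <= _); ring.
have A0 : 0 <= A by exact: dotv_ge0.
have C0 : 0 <= C by exact: dotv_ge0.
have [A00|A00] := eqVneq A 0; last first.
  have Ap : 0 < A by rewrite lt_neqAle eq_sym A00.
  have := pol (- B) A.
  rewrite (_ : _ + _ = A * (A * C - B ^+ 2)); last by ring.
  by rewrite pmulr_rge0// subr_ge0.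
rewrite A00 mul0r; have := pol (- (C + 1)) B; rewrite A00.
rewrite (_ : _ + _ = (C + 2) * - B ^+ 2); last by ring.
by rewrite pmulr_rge0 ?oppr_ge0// ltr_wpDl.
Qed.

Lemma enormZ (k : R) u : enorm (k *: u) = `|k| * enorm u.
Proof.
by rewrite /enorm dotvZl dotvZr mulrA -expr2 sqrtrM ?sqr_ge0// sqrtr_sqr.
Qed.

Lemma mulmvDr M u v : mulmv M (u + v) = mulmv M u + mulmv M v.
Proof. exact: mulmxDl. Qed.

Lemma mulmvNr M u : mulmv M (- u) = - mulmv M u.
Proof. exact: mulNmx. Qed.

Lemma mulmv_coord M u i : mulmv M u 0 i = \sum_j M i j * u 0 j.
Proof. by rewrite !mxE; apply: eq_bigr => j _; rewrite mxE mulrC. Qed.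

Lemma dotv_mulmx u v : dotv u v = (u *m v^T) 0 0.
Proof. by rewrite mxE; apply: eq_bigr => i _; rewrite mxE. Qed.

Lemma dotv_mulmv M u v : dotv (mulmv M u) v = dotv u (mulmv M^T v).
Proof. by rewrite !dotv_mulmx /mulmv trmx_mul !trmxK mulmxA. Qed.

Lemma mulmvK M u : M \in unitmx -> mulmv (invmx M) (mulmv M u) = u.
Proof. by move=> uM; rewrite /mulmv -mulmxA -trmx_mul mulVmx// trmx1 mulmx1. Qed.

Lemma mulmvVK M u : M \in unitmx -> mulmv M (mulmv (invmx M) u) = u.
Proof. by move=> uM; rewrite /mulmv -mulmxA -trmx_mul mulmxV// trmx1 mulmx1. Qed.

(** A row [u] of the kernel of the transpose satisfies [mulmv M u = 0], so coercivity forces |u|^2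
    <= 0. *)
Lemma coercive_unitmx M (a0 : R) : 0 < a0 ->
  (forall u, a0 * enorm u ^+ 2 <= dotv u (mulmv M u)) -> M \in unitmx.
Proof.
move=> a00 cM; rewrite -unitmx_tr -row_free_unit -kermx_eq0.
apply/eqP/row_matrixP => i; rewrite row0.
set u := row i _; have : mulmv M u = 0.
  by apply/sub_kermxP; exact: row_sub.
move=> Mu; have := cM u; rewrite Mu dotv_mulmx trmx0 mulmx0 mxE.
rewrite pmulr_rle0// enorm_sqr => u0.
have {u0} : dotv u u == 0 by rewrite eq_le u0 dotv_ge0.
rewrite psumr_eq0 => [|j _]; last by rewrite -expr2 sqr_ge0.
move=> /allP u0; apply/rowP => j; rewrite [RHS]mxE.
have := u0 j; rewrite mem_index_enum => /(_ isT)/=.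
by rewrite -expr2 sqrf_eq0 => /eqP.
Qed.

(** With v = M^-1 u, coercivity and Cauchy-Schwarz give a0 |v|^2 <= v . u <= |v| |u|; then divide by
    |v|. *)
Lemma coercive_enorm_invmx M (a0 : R) u : 0 < a0 ->
  (forall v, a0 * enorm v ^+ 2 <= dotv v (mulmv M v)) ->
  enorm (mulmv (invmx M) u) <= a0^-1 * enorm u.
Proof.
move=> a00 cM; have uM := coercive_unitmx a00 cM.
set v := mulmv _ u; have := cM v; rewrite mulmvVK// => cv.
have {}cv : a0 * enorm v ^+ 2 <= enorm v * enorm u.
  by apply: (le_trans cv); apply: (le_trans (ler_norm _)); exact: normr_dotv_le.
rewrite ler_pdivlMl//.
have [v0|v0] := eqVneq (enorm v) 0; first by rewrite v0 mulr0 enorm_ge0.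
have vp : 0 < enorm v by rewrite lt_neqAle eq_sym v0 enorm_ge0.
by rewrite -(ler_pM2l vp) mulrCA -expr2.
Qed.

End euclidean_space.

(** * Square-integrable vector fields *)

Section L2v_space.
Context {R : realType} {dT} {T : measurableType dT} {d : nat}.
Variables (mu : {measure set T -> \bar R}) (D : set T) (mD : measurable D).
Implicit Types (F G H : T -> 'rV[R]_d) (f g : T -> R) (M : T -> 'M[R]_d).

Lemma L2vD F G : L2v mu D F -> L2v mu D G -> L2v mu D (F + G).
Proof.
move=> F2 G2 i; under eq_fun do rewrite [(F + G) _]/(F _ + G _) mxE.
exact: L2D.
Qed.

Lemma L2vN F : L2v mu D F -> L2v mu D (- F).
Proof.
move=> F2 i; under eq_fun do rewrite [(- F) _]/(- (F _)) mxE.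
exact: L2N.
Qed.

Lemma L2vB F G : L2v mu D F -> L2v mu D G -> L2v mu D (F - G).
Proof. by move=> F2 /L2vN; exact: L2vD. Qed.

Lemma ipvC F G : ipv mu D F G = ipv mu D G F.
Proof. by apply: eq_Rintegral => x _; rewrite dotvC. Qed.

Lemma L2v_integrable_dotv F G : L2v mu D F -> L2v mu D G ->
  mu.-integrable D (EFin \o (fun x => dotv (F x) (G x))).
Proof.
move=> F2 G2; have -> : EFin \o (fun x => dotv (F x) (G x)) =
    fun x => (\sum_(i < d) (F x 0 i * G x 0 i)%:E)%E.
  by apply/funext => x /=; rewrite sumEFin.
by apply: integrable_sum => //= i _; exact: L2_integrableM.
Qed.

Lemma ipvDl F G H : L2v mu D F -> L2v mu D G -> L2v mu D H ->
  ipv mu D (F + G) H = ipv mu D F H + ipv mu D G H.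
Proof.
move=> F2 G2 H2; rewrite /ipv -RintegralD//; [|exact: L2v_integrable_dotv..].
by apply: eq_Rintegral => x _; rewrite dotvDl.
Qed.

Lemma ipvNl F G : L2v mu D F -> L2v mu D G ->
  ipv mu D (- F) G = - ipv mu D F G.
Proof.
move=> F2 G2; rewrite -mulN1r /ipv -RintegralZl//; last exact: L2v_integrable_dotv.
by apply: eq_Rintegral => x _; rewrite dotvNl mulN1r.
Qed.

Lemma ipvBl F G H : L2v mu D F -> L2v mu D G -> L2v mu D H ->
  ipv mu D (F - G) H = ipv mu D F H - ipv mu D G H.
Proof. by move=> F2 G2 H2; rewrite ipvDl ?ipvNl//; exact: L2vN. Qed.

Lemma ipvDr F G H : L2v mu D F -> L2v mu D G -> L2v mu D H ->
  ipv mu D H (F + G) = ipv mu D H F + ipv mu D H G.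
Proof. by move=> F2 G2 H2; rewrite ipvC ipvDl// !(ipvC H). Qed.

Lemma ipvNr F G : L2v mu D F -> L2v mu D G ->
  ipv mu D G (- F) = - ipv mu D G F.
Proof. by move=> F2 G2; rewrite ipvC ipvNl// ipvC. Qed.

Lemma ipvBr F G H : L2v mu D F -> L2v mu D G -> L2v mu D H ->
  ipv mu D H (F - G) = ipv mu D H F - ipv mu D H G.
Proof. by move=> F2 G2 H2; rewrite ipvC ipvBl// !(ipvC H). Qed.

Lemma measurable_dotv F G : (forall i, measurable_fun D (fun x => F x 0 i)) ->
  (forall i, measurable_fun D (fun x => G x 0 i)) ->
  measurable_fun D (fun x => dotv (F x) (G x)).
Proof.
move=> mF mG; apply: measurable_sum => i; exact: measurable_funM.
Qed.

Lemma eq_ae_Rintegral f g : measurable_fun D f -> measurable_fun D g ->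
  ae_eq mu D f g -> \int[mu]_(x in D) f x = \int[mu]_(x in D) g x.
Proof.
move=> mf mg fg; rewrite /Rintegral; congr fine; apply: ae_eq_integral => //.
- exact/measurable_EFinP.
- exact/measurable_EFinP.
- by apply: filterS fg => x /[apply] ->.
Qed.

Lemma ipv_ae_eq F G F' G' : L2v mu D F -> L2v mu D G ->
  L2v mu D F' -> L2v mu D G' ->
  ae_eq mu D F F' -> ae_eq mu D G G' -> ipv mu D F G = ipv mu D F' G'.
Proof.
move=> F2 G2 F2' G2' FF GG; apply: eq_ae_Rintegral.
- by apply: measurable_dotv => i; [case: (F2 i)|case: (G2 i)].
- by apply: measurable_dotv => i; [case: (F2' i)|case: (G2' i)].
- by apply: filterS2 FF GG => x Fx Gx Dx; rewrite Fx// Gx.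
Qed.

Lemma L2v_mulmv M F : (forall i j, Linf mu D (fun x => M x i j)) ->
  L2v mu D F -> L2v mu D (fun x => mulmv (M x) (F x)).
Proof.
move=> MLinf F2 i; under eq_fun do rewrite mulmv_coord.
by apply: L2_sum => // j; exact: LinfM_L2.
Qed.

Lemma Linfv_dotv_L2 F G : Linfv mu D F -> L2v mu D G ->
  L2 mu D (fun x => dotv (F x) (G x)).
Proof.
by move=> FLinf G2; apply: L2_sum => // j; exact: LinfM_L2.
Qed.

Lemma Linfv_scale_L2v F f : Linfv mu D F -> L2 mu D f ->
  L2v mu D (fun x => f x *: F x).
Proof.
move=> FLinf f2 i; under eq_fun do rewrite mxE mulrC.
exact: LinfM_L2.
Qed.

Lemma L2_enorm F : L2v mu D F -> L2 mu D (fun x => enorm (F x)).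
Proof.
move=> F2; have mE : measurable_fun D (fun x => dotv (F x) (F x)).
  by apply: measurable_dotv => i; case: (F2 i).
split.
  exact: measurableT_comp (continuous_measurable_fun (@sqrt_continuous R)) mE.
have := L2v_integrable_dotv F2 F2.
by apply: eq_integrable => // x _ /=; rewrite enorm_sqr.
Qed.

Lemma norm0v_enorm F : norm0v mu D F = norm0 mu D (fun x => enorm (F x)).
Proof.
by congr Num.sqrt; apply: eq_Rintegral => x _; rewrite -expr2 enorm_sqr.
Qed.

End L2v_space.

(** * Essential suprema of the coefficients *)

Section essential_bounds.
Context {R : realType} {dT} {T : measurableType dT} {d : nat}.
Variables (mu : {measure set T -> \bar R}) (D : set T) (mD : measurable D).

(** The bound [M] excludes the value +oo, which [fine] would turn into 0. If the supremum is -oo,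
    the inequality it provides at a point of [D] is absurd, because |f| is nonnegative. *)
Lemma norm_infP (f : T -> R) (M : R) :
  {ae mu, forall x, D x -> `|f x| <= M} ->
  {ae mu, forall x, D x -> `|f x| <= norm_inf mu D f}.
Proof.
move=> fM; rewrite /norm_inf; set g := _ \_ D.
have := ess_sup_ge mu g.
have supM : (ess_sup mu g <= (Num.max M 0)%:E)%E.
  apply/ess_supP; apply: filterS fM => x fx; rewrite /g patchE.
  by case: ifPn => [/set_mem/fx fM|_]; rewrite lee_fin le_max ?fM ?lexx ?orbT.
move: supM; case: (ess_sup mu g) => [s _|//|_]; apply: filterS => x.
  by move=> + Dx; rewrite /g patchE mem_set.
by move=> + Dx; rewrite /g patchE mem_set.
Qed.

(** [fine] sends both infinities to 0. A finite negative supremum cannot occur: as the function is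
    nonnegative, the whole space would be null, and the supremum would be -oo. *)
Lemma norm_inf_ge0 (f : T -> R) : 0 <= norm_inf mu D f.
Proof.
rewrite /norm_inf; set g := _ \_ D.
have g0 x : (0 <= g x)%E.
  by rewrite /g patchE; case: ifPn => // _; rewrite lee_fin.
case gs: (ess_sup mu g) => [s||]//=.
rewrite leNgt; apply/negP => s0.
have : (ess_sup mu g <= s%:E)%E by rewrite gs.
move=> /ess_supP gle.
have : ess_sup mu g = -oo%E.
  apply/ess_sup_eqNyP; apply: filterS gle => x gx; exfalso.
  by have := le_trans (g0 x) gx; rewrite lee_fin leNgt s0.
by rewrite gs.
Qed.

(** Bounds M_i on the coordinates give the bound sqrt(sum M_i^2) on the length, the finite bound
    that [norm_infP] asks for. *)
Lemma norm_infvP (F : T -> 'rV[R]_d) : Linfv mu D F ->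
  {ae mu, forall x, D x -> enorm (F x) <= norm_infv mu D F}.
Proof.
move=> FLinf.
have /choice[M FM] : forall i, exists M : R, {ae mu, forall x, D x -> `|F x 0 i| <= M}.
  by move=> i; have [_ [M]] := FLinf i; exists M.
have aeM : {ae mu, forall x, D x -> `|enorm (F x)| <= Num.sqrt (\sum_i M i ^+ 2)}.
  have : {ae mu, forall x i, D x -> `|F x 0 i| <= M i} by exact: filter_forall.
  apply: filterS => x /= FMx Dx; rewrite ger0_norm ?enorm_ge0//.
  apply: ler_wsqrtr; apply: ler_sum => i _; rewrite -expr2.
  rewrite -(real_normK (num_real _)) lerXn2r ?nnegrE ?FMx//.
  by rewrite (le_trans _ (FMx i Dx)).
apply: filterS (norm_infP aeM) => x /[apply].
by rewrite ger0_norm// enorm_ge0.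
Qed.

End essential_bounds.

(** * Lebesgue measure of cubes and integration along [cons_rV] *)

Section iterated_lebesgue.
Context {R : realType}.

Lemma coord_le_norm n (x : 'rV[R]_n) j : `|x 0 j| <= `|x|.
Proof.
change (`|x 0 j| <= mx_norm x); rewrite mx_normE.
rewrite -[leLHS]nngE num_le.
exact: (le_bigmax _ (fun i : 'I_1 * 'I_n => `|x i.1 i.2|%:nng) (0, j)).
Qed.

(** Stated by coordinates rather than with the norm, so that [cons_rV] turns it into an interval
    times a cube of lower dimension. *)
Definition cube n (M : R) : set 'rV[R]_n := [set x | forall j, `|x 0 j| <= M].

Lemma closed_cube n M : closed (@cube n M).
Proof.
rewrite (_ : cube _ = \bigcap_(j in setT) [set x : 'rV[R]_n | `|x 0 j| <= M]).
  apply: closed_bigI => j _.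
  rewrite (_ : [set _ | _] = (fun x : 'rV[R]_n => `|x 0 j|) @^-1` [set y | y <= M])//.
  apply: closed_comp; last exact: closed_le.
  move=> x _; apply: continuous_comp; first exact: coord_continuous.
  exact: norm_continuous.
by apply/seteqP; split => x /= xM j; [move=> _|]; exact: xM.
Qed.

Lemma compact_cube n M : compact (@cube n M).
Proof.
apply: bounded_closed_compact; last exact: closed_cube.
exists (Num.max M 0); split; first exact: num_real.
move=> y My x xM /=; rewrite -[leLHS]/(mx_norm x).
rewrite (le_trans _ (ltW My))// le_max.
have [->|/mx_norm_neq0[j ->]] := eqVneq (mx_norm x) 0; first by rewrite lexx orbT.
by rewrite (ord1 j.1) xM.
Qed.

Lemma measurable_cube n M : measurable (@cube n M).
Proof.
rewrite -(setCK (cube M)); apply: measurableC; apply: open_measurable_rV.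
exact/closed_openC/closed_cube.
Qed.

Lemma lebesgue_cube n M : (lebesgue_rV n (@cube n M) < +oo)%E.
Proof.
elim: n => [|n IH].
  by rewrite /= /dirac indicE ltry.
rewrite /= /lebesgue_cons /pushforward.
rewrite (_ : _ @^-1` _ = `[- M, M] `*` @cube n M).
  rewrite product_measure1E//; [|exact: measurable_cube].
  have itvE := @lebesgue_measure_itv R `[- M, M].
  have itv_fin : (@lebesgue_measure R [set` `[- M, M]%R] < +oo)%E.
    by rewrite itvE/=; case: ifPn => _; rewrite -?EFinB ltry.
  by apply: lte_mul_pinfty => //; rewrite ge0_fin_numE.
apply/seteqP; split => -[x v]/=.
  move=> xvM; split => /=.
    by have := xvM 0; rewrite mxE unlift_none/= in_itv/= ler_norml.
  by move=> j; have := xvM (lift 0 j); rewrite mxE liftK.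
rewrite in_itv/= => -[xM vM] j; rewrite mxE.
by case: unliftP => [k _|_]/=; [exact: vM|rewrite ler_norml].
Qed.

Lemma bounded_subset_cube n (D : set 'rV[R]_n) : bounded_set D ->
  exists M, D `<=` cube M.
Proof.
move=> [M [_ DM]]; exists (M + 1) => x Dx j.
have := DM (M + 1); rewrite ltrDl ltr01 => /(_ isT x Dx); apply: le_trans.
exact: coord_le_norm.
Qed.

Lemma lebesgue_bounded_fin n (D : set 'rV[R]_n) : measurable D -> bounded_set D ->
  (lebesgue_rV n D < +oo)%E.
Proof.
move=> mD /bounded_subset_cube[M DM]; apply: le_lt_trans (lebesgue_cube n M).
by apply: le_measure => //; rewrite inE//; exact: measurable_cube.
Qed.

(** [lebesgue_rV n.+1] is by definition a pushforward along [cons_rV], so this is the change of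
    variables formula; it brings integrals into the shape to which Fubini applies. *)
Lemma integral_lebesgue_cons n (f : 'rV[R]_n.+1 -> R) :
  (lebesgue_rV n.+1).-integrable setT (EFin \o f) ->
  (@lebesgue_measure R \x lebesgue_rV n)%E.-integrable setT
    (fun p => (f (cons_rV p))%:E) /\
  (\int[lebesgue_rV n.+1]_x (f x)%:E =
   \int[@lebesgue_measure R \x lebesgue_rV n]_p (f (cons_rV p))%:E)%E.
Proof.
move=> intf; have mc := @measurable_cons_rV R n.
have /integrableP[mf finf] := intf.
have intc : (@lebesgue_measure R \x lebesgue_rV n)%E.-integrable setT
    (fun p => (f (cons_rV p))%:E).
  apply/integrableP; split; first exact: (measurableT_comp mf mc).
  apply: le_lt_trans finf.
  rewrite [leRHS](@eq_measure_integral _ _ _ setT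
    (pushforward (@lebesgue_measure R \x lebesgue_rV n)%E (@cons_rV R n)))//.
  rewrite ge0_integral_pushforward//=.
  by apply/measurable_EFinP; apply: measurableT_comp => //; exact/measurable_EFinP.
split => //.
rewrite [LHS](@eq_measure_integral _ _ _ setT
    (pushforward (@lebesgue_measure R \x lebesgue_rV n)%E (@cons_rV R n)))//.
by rewrite integral_pushforward.
Qed.

End iterated_lebesgue.

(** * Integrals of partial derivatives of compactly supported functions *)

Section divergence_theorem.
Context {R : realType}.

Lemma continuous_bounded_on_compact n (f : 'rV[R]_n -> R) K :
  continuous f -> compact K -> exists M, forall x, K x -> `|f x| <= M.
Proof.
move=> cf cK; have cf' := continuous_subspaceT cf : {within K, continuous f}.
have /compact_bounded[M [_ fM]] := continuous_compact cf' cK.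
exists (M + 1) => x Kx; apply: (fM (M + 1)); first by rewrite ltrDl.
by exists x.
Qed.

Lemma continuous_compact_support_integrable n (f : 'rV[R]_n -> R) K :
  continuous f -> compact K -> (forall x, ~ K x -> f x = 0) ->
  (lebesgue_rV n).-integrable setT (EFin \o f).
Proof.
move=> cf cK f0; have mf := continuous_measurable_rVR cf.
have mK : measurable K.
  rewrite -(setCK K); apply: measurableC; apply: open_measurable_rV.
  by apply: closed_openC; apply: compact_closed cK; exact: norm_hausdorff.
have fE : EFin \o f = (EFin \o f) \_ K.
  apply/funext => x; rewrite patchE /=.
  by case: ifPn => // /negP; rewrite inE => /f0 ->.
rewrite fE -integrable_mkcond//; apply: measurable_bounded_integrable => //.
- exact/lebesgue_bounded_fin/compact_bounded.
- exact: measurable_funTS.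
- have [M fM] := continuous_bounded_on_compact cf cK.
  exists M; split; first exact: num_real.
  by move=> y My x Kx; rewrite /= (le_trans _ (ltW My))// fM.
Qed.

Lemma cons_rV_shift0 n (h x : R) (v : 'rV[R]_n) :
  cons_rV (h + x, v) = h *: delta_mx 0 0 + cons_rV (x, v).
Proof.
apply/rowP => j; rewrite !mxE eqxx /=.
by case: unliftP => [k ->|->]//=; rewrite ?mulr0 ?add0r ?mulr1.
Qed.

Lemma cons_rV_shift n (h x : R) (i : 'I_n) (v : 'rV[R]_n) :
  cons_rV (x, h *: delta_mx 0 i + v) =
  h *: delta_mx 0 (lift 0 i) + cons_rV (x, v).
Proof.
apply/rowP => j; rewrite !mxE eqxx /=.
case: unliftP => [k ->|->]/=; last by rewrite mulr0 add0r.
by rewrite !mxE eqxx/= (inj_eq lift_inj).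
Qed.

Lemma continuous_cons_rVl n (v : 'rV[R]_n) : continuous (fun x : R => cons_rV (x, v)).
Proof.
move=> x A /nbhs_ballP[e /= e0 eA]; apply/nbhs_ballP; exists e => //= y xy.
apply: eA; split => // i j; rewrite !mxE.
by case: unliftP => [k _|_]//=; exact: ballxx.
Qed.

Lemma continuous_cons_rVr n (x : R) : continuous (fun v : 'rV[R]_n => cons_rV (x, v)).
Proof.
move=> v A /nbhs_ballP[e /= e0 eA]; apply/nbhs_ballP; exists e => //= w [_ vw].
apply: eA; split => // i j; rewrite !mxE.
by case: unliftP => [k _|_]//=; exact: ballxx.
Qed.

Lemma cons_rV_cube n M (x : R) (v : 'rV[R]_n) :
  cube M (cons_rV (x, v)) <-> `|x| <= M /\ cube M v.
Proof.
split=> [xvM|[xM vM] j].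
  split; first by have := xvM 0; rewrite mxE unlift_none.
  by move=> j; have := xvM (lift 0 j); rewrite mxE liftK.
by rewrite mxE; case: unliftP => [k _|_]//=; exact: vM.
Qed.

(** The complement of [K] is open, so off [K] the function is locally the constant 0. *)
Lemma partial_support n (i : 'I_n) (f : 'rV[R]_n -> R) K : closed K ->
  (forall x, ~ K x -> f x = 0) -> forall x, ~ K x -> partial i f x = 0.
Proof.
move=> cK f0 x Kx; rewrite /partial (@near_eq_derive _ _ _ f (cst 0)) ?derive_cst//.
have : nbhs x (~` K) by apply: open_nbhs_nbhs; split => //; exact: closed_openC.
by apply: filterS => y /f0.
Qed.

Lemma integral_derive1_support (f g : R -> R) (M : R) :
  (forall x, is_derive (x : R) (1 : R) f (g x)) -> continuous g ->
  (forall x, M < `|x| -> f x = 0) -> (forall x, M < `|x| -> g x = 0) ->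
  (\int[lebesgue_measure]_x (g x)%:E = 0)%E.
Proof.
(* [M] may be negative; this [N] is positive and exceeds [M], so [f] vanishes at both ends of
   [-N, N] and [g] outside it. *)
move=> fg cg f0 g0; pose N : R := Num.max M 0 + 1.
have N0 : 0 < N by rewrite ltr_wpDl// le_max lexx orbT.
have MN : M < N by rewrite ltr_pwDr// le_max lexx.
have -> : (\int[lebesgue_measure]_x (g x)%:E =
           \int[lebesgue_measure]_(x in [set` `[- N, N]%R]) (g x)%:E)%E.
  rewrite [RHS]integral_mkcond; apply: eq_integral => x _; rewrite patchE.
  case: ifPn => // /negP; rewrite inE/= in_itv/= -ler_norml => /negP.
  by rewrite -ltNge => Nx; rewrite g0// (lt_trans MN).
have cf : continuous f.
  by move=> x; apply: differentiable_continuous; exact/derivable1_diffP.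
rewrite (@continuous_FTC2 _ g f).
- by rewrite !f0 ?normrN ?gtr0_norm// subee.
- by rewrite -subr_gt0 opprK addr_gt0.
- exact: continuous_subspaceT.
- split.
  + by move=> x _; have [] := fg x.
  + exact/cvg_at_right_filter/cf.
  + exact/cvg_at_left_filter/cf.
- by move=> x _; rewrite derive1E; exact: derive_val.
Qed.

(** Induction on the dimension, splitting off the head coordinate; the order of integration depends
    on [i]. If [i] lies in the tail, the tail is integrated first and each slice falls under the
    induction hypothesis. If [i] is the head, the head is integrated first and the inner integral is
    one-dimensional. *)
Lemma integral_partial n (i : 'I_n) (f : 'rV[R]_n -> R) M :
  (forall x, derivable f x (delta_mx 0 i)) -> continuous (partial i f) ->
  (forall x, ~ cube M x -> f x = 0) ->
  (\int[lebesgue_rV n]_x (partial i f x)%:E = 0)%E.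
Proof.
elim: n => [|n IH] in i f *; first by case: i.
move=> df cf f0; have pf0 := @partial_support _ i f _ (@closed_cube _ _ M) f0.
have := continuous_compact_support_integrable cf (@compact_cube _ _ M) pf0.
move=> /integral_lebesgue_cons[intc ->].
case: (unliftP 0 i) => [j ij|i0].
  rewrite -(integral12_prod_meas1 intc); apply: integral0_eq => x _.
  rewrite /fubini_F/=.
  (* The slice and [f] have the same difference quotients, so no chain rule is involved. *)
  have is_d v : derivable (fun w => f (cons_rV (x, w))) v (delta_mx 0 j) /\
      partial j (fun w => f (cons_rV (x, w))) v = partial i f (cons_rV (x, v)).
    rewrite /partial ij /derivable /derive.
    rewrite (_ : (fun h : R => _) = (fun h : R => h^-1 *: ((f \o shift (cons_rV (x, v)))
      (h *: delta_mx 0 (lift 0 j)) - f (cons_rV (x, v))))).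
      by split => //; rewrite -ij; exact: df.
    by apply/funext => h /=; rewrite cons_rV_shift.
  rewrite -[RHS](IH j (fun w => f (cons_rV (x, w)))).
  - by apply: eq_integral => v _; rewrite (is_d v).2.
  - by move=> v; exact: (is_d v).1.
  - rewrite (_ : partial _ _ = partial i f \o (fun w => cons_rV (x, w))).
      by move=> v; apply: continuous_comp; [exact: continuous_cons_rVr|exact: cf].
    by apply/funext => v; rewrite (is_d v).2.
  - by move=> v vM; apply: f0 => /cons_rV_cube[].
rewrite -(integral21_prod_meas1 intc); apply: integral0_eq => v _.
rewrite /fubini_G/=.
apply: (@integral_derive1_support (fun x => f (cons_rV (x, v))) _ M).
- move=> x.
  have E : (fun h : R => h^-1 *: (((fun x => f (cons_rV (x, v))) \o shift x) (h *: (1 : R))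
      - f (cons_rV (x, v)))) = (fun h : R => h^-1 *: ((f \o shift (cons_rV (x, v)))
      (h *: delta_mx 0 0) - f (cons_rV (x, v)))).
    by apply/funext => h /=; rewrite [h%:A]mulr1 cons_rV_shift0.
  split.
    by rewrite /derivable E -i0; exact: df.
  by rewrite /partial /derive E -i0.
- move=> x; apply: (@continuous_comp _ _ _ (fun x => cons_rV (x, v)) (partial i f)).
    exact: continuous_cons_rVl.
  exact: cf.
- by move=> x Mx; apply: f0 => /cons_rV_cube[]; rewrite leNgt Mx.
- by move=> x Mx; apply: pf0 => /cons_rV_cube[]; rewrite leNgt Mx.
Qed.

End divergence_theorem.

(** * The flat function exp(-1/t) and its derivatives *)

Section flat_function.
Context {R : realType}.
Implicit Types (p : {poly R}) (t : R).

(* The family t |-> p(1/t) exp(-1/t) (t > 0), extended by 0, is stable under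
   differentiation. *)
Definition flat p t : R := if 0 < t then p.[t^-1] * expR (- t^-1) else 0.

Lemma horner_norm_le p t : 1 <= t ->
  `|p.[t]| <= (\sum_(i < size p) `|p`_i|) * t ^+ size p.
Proof.
move=> t1; rewrite horner_coef mulr_suml (le_trans (ler_norm_sum _ _ _))//.
apply: ler_sum => i _; rewrite normrM ler_wpM2l// ger0_norm; last first.
  by rewrite exprn_ge0// (le_trans ler01).
by rewrite ler_weXn2l// ltnW.
Qed.

(** For 0 < t < 1 put s = 1/t and let n be the size of p: |p(s)| <= S s^n, whereas exp(s) >= s^(n+1)
    / (n+1)!. The spare power of s becomes the factor |t|. Differentiability at 0 rests on this
    bound. *)
Lemma flat_le p : exists C : R, 0 <= C /\ forall t, t < 1 -> `|flat p t| <= C * `|t|.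
Proof.
pose S := \sum_(i < size p) `|p`_i|; pose n := size p.
have S0 : 0 <= S by apply: sumr_ge0.
exists (S * n.+1`!%:R); split; first by rewrite mulr_ge0.
move=> t t1; rewrite /flat; case: ifPn => [t0|_]; last first.
  by rewrite normr0 !mulr_ge0.
rewrite (ger0_norm (ltW t0)) normrM (ger0_norm (expR_ge0 _)).
pose s := t^-1; have s0 : 0 < s by rewrite invr_gt0.
have s1 : 1 <= s by rewrite invf_ge1// ltW.
have -> : t = s^-1 by rewrite invrK.
rewrite invrK expRN.
have es : s ^+ n.+1 / n.+1`!%:R <= expR s.
  by rewrite (le_trans _ (expR_ge1Dxn n (ltW s0)))// lerDr.
have eVs : (expR s)^-1 <= n.+1`!%:R / s ^+ n.+1.
  rewrite -(invrK (n.+1`!%:R / _)) invf_div lef_pV2// posrE ?expR_gt0//.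
  by rewrite divr_gt0// ?exprn_gt0// ltr0n fact_gt0.
apply: (@le_trans _ _ ((S * s ^+ n) * (n.+1`!%:R / s ^+ n.+1))).
  by apply: ler_pM => //; exact: horner_norm_le.
rewrite le_eqVlt; apply/orP; left; apply/eqP.
rewrite exprS; field.
by rewrite expf_neq0 gt_eqF.
Qed.

(** For t > 0 the product and chain rules give t^-2 (p - p')(1/t) exp(-1/t), whence the new
    polynomial. At 0 the difference quotient of [flat p] is [flat ('X * p)], which tends to 0 by
    [flat_le]. *)
Lemma is_derive_flat p t : is_derive t (1 : R) (flat p) (flat ('X ^+ 2 * (p - p^`())) t).
Proof.
have [t0|t0|t0] := ltgtP t 0.
- apply: (@near_eq_is_derive _ _ _ (cst 0)); last first.
    by rewrite /flat ltNge (ltW t0)/=; exact: is_derive_cst.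
  near=> s; rewrite /flat ltNge (_ : s <= 0)//=; near: s.
  by apply: filterS (lt_nbhsl t0) => y /ltW.
- pose g : R -> R := (horner p \o GRing.inv) * (expR \o (fun s => - s^-1)).
  apply: (@near_eq_is_derive _ _ _ g).
    by near=> s; rewrite /flat (_ : 0 < s)//; near: s; exact: (lt_nbhsr t0).
  have tn0 : t != 0 by rewrite gt_eqF.
  have dV : is_derive t (1 : R) (fun s : R => s^-1) (- t ^- 2).
    have := @is_deriveV _ id t 1 1 tn0 (is_derive_id _ _).
    by move=> /is_derive_eq; apply; rewrite /= scaler1.
  have dN : is_derive t (1 : R) (fun s : R => - s^-1) (t ^- 2).
    by have := is_deriveN dV; rewrite opprK.
  have d1 := is_derive1_comp (is_derive_poly p t^-1) dV.
  have d2 := @is_derive1_comp _ expR (fun s => - s^-1) _ _ _ (is_derive_expR _) dN.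
  have := is_deriveM d1 d2.
  move=> /is_derive_eq; apply.
  rewrite /flat t0 /= !(hornerE, hornerXn).
  rewrite /GRing.scale/= -exprVn; ring.
- rewrite t0 [X in is_derive _ _ _ X]/flat ltxx; have [C [C0 flatC]] := flat_le ('X * p).
  have lim0 : (h^-1 *: ((flat p \o shift 0) (h *: (1 : R)) - flat p 0))
      @[h --> (0 : R)^'] --> (0 : R).
    rewrite (_ : (fun h : R => _) = flat ('X * p)); last first.
      apply/funext => h /=; rewrite addr0 /flat ltxx subr0.
      rewrite /GRing.scale/= mulr1; case: ifPn => _; last by rewrite mulr0.
      by rewrite hornerM hornerX mulrA.
    apply: cvg_within_filter.
    apply/cvgr0Pnorm_lt => e e0; near=> h.
    apply: (@le_lt_trans _ _ (C * `|h|)).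
      by apply: flatC; near: h; apply: lt_nbhsl.
    (* [C] may be 0; [C + 1] is positive and can be divided by. *)
    apply: (@le_lt_trans _ _ ((C + 1) * `|h|)).
      by rewrite ler_wpM2r// lerDl.
    rewrite mulrC -ltr_pdivlMr ?ltr_wpDl//; near: h.
    by apply: (@pseudometric_normed_Zmodule.nbhs0_lt R R^o); rewrite divr_gt0// ltr_wpDl.
  split; first by apply/cvg_ex; exists 0.
  exact: cvg_lim lim0.
Unshelve. all: by end_near. Qed.

Lemma flat_continuous p : continuous (flat p).
Proof.
move=> t; apply: differentiable_continuous; apply/derivable1_diffP.
by have [] := is_derive_flat p t.
Qed.

(** Its limit 1 at +oo, together with its vanishing for t <= 0, makes steeper and steeper copies
    approach an indicator function. *)
Definition step : R -> R := flat 1.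

Lemma stepE t : step t = if 0 < t then expR (- t^-1) else 0.
Proof. by rewrite /step /flat hornerC mul1r. Qed.

Lemma step_ge0 t : 0 <= step t.
Proof. by rewrite stepE; case: ifP => // _; exact: expR_ge0. Qed.

Lemma step_le1 t : step t <= 1.
Proof.
rewrite stepE; case: ifPn => // t0.
by rewrite -expR0 ler_expR oppr_le0 invr_ge0 ltW.
Qed.

Lemma step_le0 t : t <= 0 -> step t = 0.
Proof. by rewrite stepE ltNge => ->. Qed.

Lemma cvg_step (u : R^nat) : u @ \oo --> +oo%R -> (step \o u) n @[n --> \oo] --> (1 : R).
Proof.
move=> uoo.
have u0 : \forall n \near \oo, 0 < u n by move/cvgryPgt : uoo; exact.
have Vu : (u n)^-1 @[n --> \oo] --> (0 : R).
  by apply/gtr0_cvgV0.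
have : expR (- (u n)^-1) @[n --> \oo] --> expR (- 0).
  by apply: (continuous_cvg _ (@continuous_expR R _)); exact: cvgN.
rewrite oppr0 expR0; apply: cvg_trans; apply: near_eq_cvg.
by apply: filterS u0 => n un0 /=; rewrite stepE un0.
Qed.

End flat_function.

(** * Calculus of C^k functions of several variables *)

Section smooth_functions.
Context {R : realType} {n : nat}.
Implicit Types (f g : 'rV[R]_n -> R) (x : 'rV[R]_n).

Lemma Ck_continuous k f : Ck k f -> continuous f.
Proof. by case: k => [|k] []. Qed.

Lemma CkS k f : Ck k.+1 f -> Ck k f.
Proof.
elim: k f => [|k IH] f; first by move=> [].
by move=> [cf dCf]; split => // i; have [df /IH] := dCf i.
Qed.

Lemma Ck_cst k (a : R) : Ck k (cst a : 'rV[R]_n -> R).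
Proof.
elim: k a => [|k IH] a; split => //; try exact: cst_continuous.
move=> i; split; first by move=> x; exact: derivable_cst.
rewrite (_ : partial i (cst a) = cst 0); first exact: IH.
by apply/funext => x; rewrite /partial derive_cst.
Qed.

Lemma CkD k f g : Ck k f -> Ck k g -> Ck k (f + g).
Proof.
elim: k f g => [|k IH] f g [cf Cf] [cg Cg]; split => //.
- by move=> x; apply: continuousD; [exact: cf|exact: cg].
- by move=> x; apply: continuousD; [exact: cf|exact: cg].
move=> i; have [df Cpf] := Cf i; have [dg Cpg] := Cg i.
split; first by move=> x; apply: derivableD.
rewrite (_ : partial i (f + g) = partial i f + partial i g); first exact: IH.
by apply/funext => x; rewrite /partial deriveD.
Qed.

Lemma CkM k f g : Ck k f -> Ck k g -> Ck k (f * g).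
Proof.
elim: k f g => [|k IH] f g /[dup] Ckf [cf Cf] /[dup] Ckg [cg Cg]; split => //.
- by move=> x; apply: continuousM; [exact: cf|exact: cg].
- by move=> x; apply: continuousM; [exact: cf|exact: cg].
move=> i; have [df Cpf] := Cf i; have [dg Cpg] := Cg i.
split; first by move=> x; apply: derivableM.
rewrite (_ : partial i (f * g) = f * partial i g + g * partial i f).
  by apply: CkD; apply: IH => //; exact: CkS.
by apply/funext => x; rewrite /partial deriveM.
Qed.

(** Reduces a directional derivative to one variable, where the chain rule is applied; both
    difference quotients are the same function. *)
Lemma is_derive_line f x v (l : R) :
  is_derive (0 : R) (1 : R) (fun h : R => f (h *: v + x)) l -> is_derive x v f l.
Proof.
move=> [df <-]; rewrite /derivable/= in df.
have E : (fun h : R => h^-1 *: (((fun h : R => f (h *: v + x)) \o shift 0) (h *: (1 : R))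
      - f (0 *: v + x))) = (fun h : R => h^-1 *: ((f \o shift x) (h *: v) - f x)).
  by apply/funext => h /=; rewrite addr0 [h%:A]mulr1 scale0r add0r.
by split; [rewrite /derivable -E|rewrite /derive -E].
Qed.

Lemma is_derive_flat_coord (p : {poly R}) (a c : R) (i j : 'I_n) x :
  is_derive x (delta_mx 0 i) (fun x => flat p (a * x 0 j + c))
    ((i == j)%:R * a * flat ('X ^+ 2 * (p - p^`())) (a * x 0 j + c)).
Proof.
apply: is_derive_line.
pose e : R := (i == j)%:R.
rewrite (_ : (fun h : R => _) =
    flat p \o (fun h : R => h * (a * e) + (a * x 0 j + c))); last first.
  apply/funext => h /=; rewrite !mxE eqxx/= /e [in RHS]eq_sym; congr (flat p _).
  by ring.
have dl : is_derive (0 : R) (1 : R) (fun h : R => h * (a * e) + (a * x 0 j + c)) (a * e).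
  have d1 : is_derive (0 : R) (1 : R) (fun h : R => h * (a * e)) (a * e).
    have := @is_deriveM _ _ id (cst (a * e)) (0 : R) (1 : R) _ _
      (is_derive_id _ _) (is_derive_cst _ _ _).
    by move=> /is_derive_eq; apply; rewrite scaler0 add0r [_ *: _]mulr1.
  have := @is_deriveD _ _ _ _ (cst (a * x 0 j + c)) _ _ _ _ d1 (is_derive_cst _ _ _).
  by rewrite addr0.
have df := is_derive_flat p (0 * (a * e) + (a * x 0 j + c)).
have := @is_derive1_comp _ (flat p)
  (fun h : R => h * (a * e) + (a * x 0 j + c)) _ _ _ df dl.
by move=> /is_derive_eq; apply; rewrite mul0r add0r /e; ring.
Qed.

(** The induction on [k] must range over all [p], since each partial derivative replaces p by X^2 (p
    - p'), up to a constant factor. *)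
Lemma Ck_flat_coord k (p : {poly R}) (a c : R) (j : 'I_n) :
  Ck k (fun x : 'rV[R]_n => flat p (a * x 0 j + c)).
Proof.
have cf q : continuous (fun x : 'rV[R]_n => flat q (a * x 0 j + c)).
  move=> x; apply: (@continuous_comp _ _ _ (fun x : 'rV[R]_n => a * x 0 j + c) (flat q)).
    apply: continuousD; last exact: cst_continuous.
    by apply: continuousM; [exact: cst_continuous|exact: coord_continuous].
  exact: flat_continuous.
elim: k p => [|k IH] p; split => // i; split.
  by move=> x; have [] := is_derive_flat_coord p a c i j x.
rewrite (_ : partial i _ = cst ((i == j)%:R * a) *
    (fun x => flat ('X ^+ 2 * (p - p^`())) (a * x 0 j + c))).
  by apply: CkM => //; exact: Ck_cst.
by apply/funext => x; rewrite /partial; have [_ ->] := is_derive_flat_coord p a c i j x.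
Qed.

Lemma smooth_cst (a : R) : smooth (cst a : 'rV[R]_n -> R).
Proof. by move=> k; exact: Ck_cst. Qed.

Lemma smoothD f g : smooth f -> smooth g -> smooth (f + g).
Proof. by move=> sf sg k; apply: CkD. Qed.

Lemma smoothM f g : smooth f -> smooth g -> smooth (f * g).
Proof. by move=> sf sg k; apply: CkM. Qed.

Lemma smooth_prod m (f : 'I_m -> 'rV[R]_n -> R) : (forall i, smooth (f i)) ->
  smooth (fun x => \prod_i f i x).
Proof.
elim: m f => [|m IH] f sf.
  by under eq_fun do rewrite big_ord0; exact: smooth_cst.
under eq_fun do rewrite big_ord_recl; apply: smoothM => //; exact: IH.
Qed.

Lemma smooth_continuous f : smooth f -> continuous f.
Proof. by move=> sf; exact: Ck_continuous (sf 0%N). Qed.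

Lemma smooth_derivable f i x : smooth f -> derivable f x (delta_mx 0 i).
Proof. by move=> /(_ 1%N)[_ /(_ i)[]]. Qed.

Lemma smooth_partial f i : smooth f -> smooth (partial i f).
Proof. by move=> sf k; have [_ /(_ i)[]] := sf k.+1. Qed.

Lemma partialM f g i : smooth f -> smooth g ->
  partial i (f * g) = fun x => f x * partial i g x + g x * partial i f x.
Proof.
by move=> sf sg; apply/funext => x; rewrite /partial deriveM//; exact: smooth_derivable.
Qed.

End smooth_functions.

(** * Smooth approximation of indicators of open sets *)

Section test_functions.
Context {R : realType} {n : nat}.
Implicit Types (U : set 'rV[R]_n) (f g phi psi : 'rV[R]_n -> R).

Lemma test_functionW U V phi : U `<=` V -> test_function U phi -> test_function V phi.
Proof.
by move=> UV [sp [K [cK KU K0]]]; split => //; exists K; split => //; exact: subset_trans UV.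
Qed.

Lemma test_function0 U : test_function U (cst 0).
Proof.
by split; [exact: smooth_cst|exists set0; split => //; exact: compact0].
Qed.

Lemma test_function_out U phi x : test_function U phi -> ~ U x -> phi x = 0.
Proof. by move=> [_ [K [_ KU K0]]] Ux; apply: K0 => /KU. Qed.

(** The combination equals phi + psi - phi psi, supported in the union of the two supports. For
    functions with values in [0, 1] it stays in [0, 1] and dominates both, so it serves as a smooth
    union. *)
Lemma test_functionU U phi psi : test_function U phi -> test_function U psi ->
  test_function U (fun x => 1 - (1 - phi x) * (1 - psi x)).
Proof.
move=> [sp [K [cK KU K0]]] [sq [L [cL LU L0]]]; split; last first.
  exists (K `|` L); split; first exact: compactU.
    by rewrite subUset.
  by move=> x /not_orP[/K0 -> /L0 ->]; rewrite !subr0 mulr1 subrr.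
rewrite (_ : (fun x => _) = phi + psi + cst (-1) * (phi * psi)).
  by apply: smoothD; [exact: smoothD|apply: smoothM; [exact: smooth_cst|exact: smoothM]].
by apply/funext => x; rewrite /= !fctE; ring.
Qed.

Lemma test_function_bigU U m (phi : 'I_m -> 'rV[R]_n -> R) :
  (forall i, test_function U (phi i)) ->
  test_function U (fun x => 1 - \prod_i (1 - phi i x)).
Proof.
elim: m phi => [|m IH] phi tphi.
  under eq_fun do rewrite big_ord0 subrr; exact: test_function0.
have := test_functionU (tphi 0) (IH (fun i => phi (lift 0 i)) (fun i => tphi _)).
congr (test_function _ _); apply/funext => x.
by rewrite big_ord_recl subKr.
Qed.

(** Balls of the sup norm are boxes. The arguments of [step] are N+1 times the signed distances of
    x_j to the two faces, minus 1. The subtracted 1 confines the support to radius r - 1/(N+1),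
    making it compact in the open ball; the factor N+1 drives the arguments to +oo inside. They are
    written as affine functions of x_j to fit [Ck_flat_coord]. *)
Definition box_bump (c : 'rV[R]_n) (r : R) (N : nat) : 'rV[R]_n -> R :=
  fun x => \prod_j (step (N.+1%:R * x 0 j + (N.+1%:R * (r - c 0 j) - 1)) *
                    step (- N.+1%:R * x 0 j + (N.+1%:R * (r + c 0 j) - 1))).

Lemma box_bump_in01 c r N x : 0 <= box_bump c r N x <= 1.
Proof.
apply/andP; split.
  by apply: prodr_ge0 => j _; rewrite mulr_ge0// step_ge0.
apply: prodr_ile1 => j _.
rewrite mulr_ge0 ?step_ge0//= -[leRHS]mulr1.
by apply: ler_pM; rewrite ?step_ge0 ?step_le1.
Qed.

Lemma test_function_box_bump c r N : 0 < r -> test_function (ball c r) (box_bump c r N).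
Proof.
move=> r0; split.
  rewrite /box_bump; apply: smooth_prod => j.
  by apply: smoothM => k; exact: Ck_flat_coord.
pose s : R := r - N.+1%:R^-1.
exists [set x : 'rV[R]_n | forall j, `|c 0 j - x 0 j| <= s].
have N0 : (0 : R) < N.+1%:R by rewrite ltr0n.
split.
- rewrite (_ : [set x | _] = (fun x => c + x) @` cube s).
    apply: continuous_compact; last exact: compact_cube.
    apply: continuous_subspaceT => x; apply: continuousD => //; exact: cst_continuous.
  apply/seteqP; split => [x /= xs|_ [y ys <-] j]/=; last first.
    by rewrite mxE opprD addrA subrr sub0r normrN.
  exists (x - c); last by rewrite addrC subrK.
  by move=> j; rewrite !mxE distrC.
- move=> x xs; split => // i j; rewrite ord1 /ball/=.
  by rewrite (le_lt_trans (xs j))// /s ltrBlDr ltrDl invr_gt0.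
- move=> x /= /existsNP[j /negP]; rewrite -ltNge => sj.
  rewrite /box_bump (bigD1 j)//=.
  suff -> : step (N.+1%:R * x 0 j + (N.+1%:R * (r - c 0 j) - 1)) *
      step (- N.+1%:R * x 0 j + (N.+1%:R * (r + c 0 j) - 1)) = 0 by rewrite mul0r.
  move: sj; rewrite ltr_normr => /orP[sj|sj].
  + rewrite step_le0 ?mul0r//.
    rewrite (_ : _ + _ = N.+1%:R * (s - (c 0 j - x 0 j))).
      by rewrite pmulr_rle0// subr_le0 ltW.
    by rewrite /s; field; rewrite gt_eqF.
  + rewrite [X in _ * X]step_le0 ?mulr0//.
    rewrite (_ : _ + _ = N.+1%:R * (s - - (c 0 j - x 0 j))).
      by rewrite pmulr_rle0// subr_le0 ltW.
    by rewrite /s; field; rewrite gt_eqF.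
Qed.

Lemma cvg_natSM_pinfty (a : R) : 0 < a ->
  (fun N : nat => N.+1%:R * a - 1) @ \oo --> +oo%R.
Proof.
move=> a0; apply/cvgryPge => A; near=> N.
rewrite lerBrDr -ler_pdivrMr//.
apply: (@le_trans _ _ N%:R); last by rewrite ler_nat.
by near: N; exact: nbhs_infty_ger.
Unshelve. all: by end_near. Qed.

Lemma cvg_box_bump c r x : ball c r x ->
  (fun N => box_bump c r N x) @ \oo --> (1 : R).
Proof.
move=> [_ cx].
rewrite -[X in _ --> X](@big1_eq _ _ *%R _ (index_enum 'I_n) xpredT).
apply: (cvg_big (@mul_continuous R)) => // j _; rewrite -[X in _ --> X]mulr1.
have := cx 0 j; rewrite /ball/= ltr_norml => /andP[cx1 cx2].
apply: cvgM; apply: cvg_step.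
- rewrite (_ : (fun _ => _) = (fun N : nat => N.+1%:R * (x 0 j + (r - c 0 j)) - 1)).
    by apply: cvg_natSM_pinfty; move: cx2; lra.
  by apply/funext => N; ring.
- rewrite (_ : (fun _ => _) = (fun N : nat => N.+1%:R * (- x 0 j + (r + c 0 j)) - 1)).
    by apply: cvg_natSM_pinfty; move: cx1; lra.
  by apply/funext => N; ring.
Qed.

(** Smooth union of bumps on those rational balls inside [U] whose code is below [N]. The same [N]
    counts the balls and sharpens each bump; a code that names no ball inside [U] contributes the
    neutral factor 1. *)
Definition open_bump U (N : nat) : 'rV[R]_n -> R := fun x =>
  1 - \prod_(k < N) (1 - (if unpickle k is Some i then
      if `[< rat_ball i `<=` U >] then
        box_bump (map_mx ratr (i : 'rV[rat]_n * nat).1) i.2.+1%:R^-1 N x else 0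
    else 0)).

Lemma test_function_open_bump U N : test_function U (open_bump U N).
Proof.
apply: test_function_bigU => k.
case: (unpickle k) => [i|]; last exact: test_function0.
case: asboolP => iU; last exact: test_function0.
by apply: (test_functionW iU); apply: test_function_box_bump; rewrite invr_gt0.
Qed.

Let factor_in01 U N k x : 0 <= 1 - (if unpickle k is Some i then
      if `[< rat_ball i `<=` U >] then
        box_bump (map_mx ratr (i : 'rV[rat]_n * nat).1) i.2.+1%:R^-1 N x else 0
    else 0) <= 1.
Proof.
case: (unpickle k) => [i|]; last by rewrite subr0 ler01 lexx.
case: ifP => _; last by rewrite subr0 ler01 lexx.
have /andP[b0 b1] := box_bump_in01 (map_mx ratr i.1) i.2.+1%:R^-1 N x.
by rewrite subr_ge0 b1 lerBlDr lerDl.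
Qed.

Lemma open_bump_in01 U N x : 0 <= open_bump U N x <= 1.
Proof.
rewrite /open_bump subr_ge0 lerBlDr lerDl; apply/andP; split.
  by apply: prodr_ile1 => k _; exact: factor_in01.
by apply: prodr_ge0 => k _; have /andP[] := factor_in01 U N k x.
Qed.

(** Once [N] exceeds the code of a rational ball around [x] inside [U], the value lies between the
    [box_bump] of that ball and 1. *)
Lemma cvg_open_bump U x : open U -> U x ->
  (fun N => open_bump U N x) @ \oo --> (1 : R).
Proof.
move=> oU Ux.
have : (\bigcup_i (if `[< rat_ball i `<=` U >] then rat_ball i else set0)) x.
  by rewrite -open_bigcup_rat_ball.
move=> [i _]; case: asboolP => // iU ix.
have b1 := cvg_box_bump ix.
apply: (@squeeze_cvgr _ _ _ _
    (fun N => box_bump (map_mx ratr i.1) i.2.+1%:R^-1 N x) (cst 1)) => //;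
  last exact: cvg_cst.
near=> N; have /andP[_ ->] := open_bump_in01 U N x; rewrite andbT.
have iN : (pickle i < N)%N by near: N; exact: nbhs_infty_gt.
rewrite /open_bump lerBrDr -lerBrDl (bigD1 (Ordinal iN))//= pickleK asboolT//.
rewrite -[leRHS]mulr1 ler_wpM2l//.
  by rewrite subr_ge0; have /andP[] := box_bump_in01 (map_mx ratr i.1) i.2.+1%:R^-1 N x.
by apply: prodr_ile1 => k _; exact: factor_in01.
Unshelve. all: by end_near. Qed.

End test_functions.

(** * Fundamental lemma and uniqueness of weak derivatives *)

Section weak_derivatives.
Context {R : realType} {d : nat}.
Variables (Omega : set 'rV[R]_d) (oO : open Omega) (bO : bounded_set Omega).
Implicit Types (u v g phi psi : 'rV[R]_d -> R) (F G : 'rV[R]_d -> 'rV[R]_d).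
Local Notation mu := (lebesgue_rV d).

Let mO : measurable Omega. Proof. exact: open_measurable_rV. Qed.

Lemma continuous_L2 phi : continuous phi -> L2 mu Omega phi.
Proof.
move=> cphi; have mphi : measurable_fun Omega phi.
  by apply: measurable_funTS; exact: continuous_measurable_rVR.
split=> //; apply: measurable_bounded_integrable => //.
- exact: lebesgue_bounded_fin.
- exact: measurable_funX.
- have [M OM] := bounded_subset_cube bO.
  have [B phiB] := continuous_bounded_on_compact cphi (@compact_cube _ _ M).
  exists (B ^+ 2); split; first exact: num_real.
  move=> y By x Ox /=; rewrite (le_trans _ (ltW By))// normrX.
  by rewrite lerXn2r ?nnegrE ?phiB ?(le_trans _ (phiB x _))//; exact: OM.
Qed.

Lemma test_function_L2 phi : test_function Omega phi -> L2 mu Omega phi.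
Proof. by move=> [sphi _]; exact/continuous_L2/smooth_continuous. Qed.

(** [Omega] is bounded, so the constant 1 is square integrable and g = g . 1 is a product of two L^2
    functions. *)
Lemma L2_integrable g : L2 mu Omega g -> mu.-integrable Omega (EFin \o g).
Proof.
move=> g2; have := L2_integrableM mO g2 (continuous_L2 (@cst_continuous _ _ (1 : R))).
by apply: eq_integrable => // x _ /=; rewrite mulr1.
Qed.

(** Pairing [g] with the bumps of [V] always gives 0; as the bumps take values in [0, 1] and
    converge to the indicator of [V], dominated convergence with majorant |g| carries this to the
    integral over [V]. *)
Lemma integral_open_eq0 g U : L2 mu Omega g ->
  (forall phi, test_function Omega phi -> ip mu Omega g phi = 0) ->
  open U -> (\int[mu]_(x in Omega `&` U) (g x)%:E = 0)%E.
Proof.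
move=> g2 g0 oU; pose V := Omega `&` U; have oV : open V by exact: openI.
have mg : measurable_fun Omega g by case: g2.
have tV N : test_function Omega (open_bump V N).
  by apply: test_functionW (test_function_open_bump V N) => x [].
pose f_ N x := (g x * open_bump V N x)%:E.
pose f x := ((EFin \o g) \_ V) x.
have mf_ N : measurable_fun Omega (f_ N).
  apply/measurable_EFinP/measurable_funM => //.
  by have [] := test_function_L2 (tV N).
have mf : measurable_fun Omega f.
  apply/(measurable_restrict _ _ _) => //; first exact: open_measurable_rV.
  by apply: (measurable_funS mO) => [x []//|]; exact/measurable_EFinP.
have f_f : {ae mu, forall x, Omega x -> f_ ^~ x @ \oo --> f x}.
  apply: aeW => x Ox; rewrite /f patchE; case: ifPn => [/set_mem Vx|/negP].
    apply: cvg_EFin; first exact: nearW.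
    rewrite -[X in _ --> X]mulr1; apply: cvgM; first exact: cvg_cst.
    exact: cvg_open_bump.
  rewrite inE => Vx; rewrite (_ : (fun N => f_ N x) = cst 0%E); first exact: cvg_cst.
  apply/funext => N; rewrite /f_ (test_function_out (test_function_open_bump V N))//.
  by rewrite mulr0.
have f_g : {ae mu, forall x N, Omega x -> (`|f_ N x| <= `|(g x)%:E|)%E}.
  apply: aeW => x N Ox; rewrite lee_fin normrM ler_piMr//.
  by have /andP[b0 b1] := open_bump_in01 V N x; rewrite ger0_norm.
have ig := integrable_abse (L2_integrable g2).
have [_ _] := dominated_convergence mO mf_ mf f_f ig f_g.
rewrite (_ : (fun N => _) = cst 0%E); last first.
  apply/funext => N /=; have := g0 _ (tV N); rewrite /ip /Rintegral => I0.
  rewrite -[LHS]fineK ?I0//; apply: (integrable_fin_num mO).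
  by apply: (L2_integrableM mO g2); exact: test_function_L2.
move=> /(cvg_unique (@ereal_hausdorff R) (cvg_cst 0%E)) f0.
rewrite [RHS]f0 /f integral_mkcondr; apply: eq_integral => x /set_mem Ox.
by rewrite !patchE /V in_setI (mem_set Ox).
Qed.

Lemma fundamental_lemma_calculus_of_variations g : L2 mu Omega g ->
  (forall phi, test_function Omega phi -> ip mu Omega g phi = 0) ->
  ae_eq mu Omega g (cst 0).
Proof.
move=> g2 g0; have ig := L2_integrable g2.
have mg : measurable_fun Omega (EFin \o g) by case/integrableP : ig.
pose P S := (\int[mu]_(x in Omega `&` S) (g x)%:E = 0)%E.
(* The total integral vanishes; this settles complements in the Dynkin induction. *)
have PT : P setT by apply: integral_open_eq0 => //; exact: openT.
have sub_int S : measurable S -> mu.-integrable (Omega `&` S) (EFin \o g).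
  by move=> mS; apply: integrableS ig => //; exact: measurableI.
have Pm S : measurable S -> P S.
  move=> mS; apply: (@dynkin_induction _ _ (@open 'rV[R]_d)) => //.
  - exact: openI.
  - by move=> U oU; exact: integral_open_eq0.
  - move=> {mS}S mS PS; move: PT; rewrite /P setIT.
    rewrite -{1}(setIT Omega) -(setvU S) setIUr setUC integral_setU//.
    + by rewrite PS add0e.
    + exact: measurableI.
    + by apply: measurableI => //; exact: measurableC.
    + by rewrite -setIUr setUC setvU setIT.
    + by apply/disj_setPS => x [[_ Sx] [_]].
  - move=> F mF tF PF; rewrite /P setI_bigcupr integral_bigcup.
    + by apply: eseries0 => k _ _; exact: PF.
    + apply/trivIsetP => i j _ _ ij; rewrite setIACA setIid.
      by move/trivIsetP : tF => /(_ i j Logic.I Logic.I ij) ->; rewrite setI0.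
    + by move=> k; exact: measurableI.
    + by rewrite -setI_bigcupr; apply: sub_int; exact: bigcup_measurable.
have : ae_eq mu Omega (EFin \o g) (cst 0%E).
  apply: integral_ae_eq => // E EO mE.
  by rewrite integral0 -(setIidr EO); exact: Pm.
by apply: filterS => x /[apply] -[].
Qed.

(** The partial derivative of phi psi integrates to 0 over the whole space and vanishes off the
    support [K] of psi, hence off [Omega]; the product rule splits it into the two pairings. *)
Lemma ip_partial phi psi i : smooth phi -> test_function Omega psi ->
  ip mu Omega phi (partial i psi) = - ip mu Omega (partial i phi) psi.
Proof.
move=> sphi /[dup] tpsi [spsi [K [cK KO K0]]].
have L2s f : smooth f -> L2 mu Omega f by move=> /smooth_continuous/continuous_L2.
apply/eqP; rewrite -addr_eq0 /ip -RintegralD//; last first.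
- by apply: L2_integrableM => //; apply: L2s => //; exact: smooth_partial.
- by apply: L2_integrableM => //; apply: L2s => //; exact: smooth_partial.
have sM := smoothM sphi spsi.
have cK' : closed K by apply: compact_closed cK; exact: norm_hausdorff.
have M0 x : ~ K x -> (phi * psi) x = 0 by move=> /K0; rewrite !fctE => ->; rewrite mulr0.
have pM0 := @partial_support _ _ i _ _ cK' M0.
have [M KM] := bounded_subset_cube (compact_bounded cK).
have := @integral_partial _ _ i (phi * psi) M (fun x => @smooth_derivable _ _ _ i x sM)
  (smooth_continuous (@smooth_partial _ _ _ i sM))
  (fun x xM => M0 x (fun Kx => xM (KM _ Kx))).
rewrite /Rintegral => I0; rewrite -[X in _ == X]/(fine 0%E); apply/eqP; congr fine.
rewrite -[RHS]I0 integral_mkcond; apply: eq_integral => x _.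
rewrite patchE; case: ifPn => [_|/negP]; first by rewrite partialM// (mulrC (psi x)).
by rewrite inE => Ox; rewrite pM0// => /KO.
Qed.

Lemma smooth_weak_gradient phi : smooth phi ->
  weak_gradient Omega phi (fun x => \row_i partial i phi x).
Proof.
move=> sphi; split=> [i|psi i tpsi].
  by under eq_fun do rewrite mxE; exact/continuous_L2/smooth_continuous/smooth_partial.
under [X in - ip _ _ X _]eq_fun do rewrite mxE.
exact: ip_partial.
Qed.

Lemma smooth_H1 phi : smooth phi -> H1 Omega phi.
Proof.
move=> sphi; split; first exact/continuous_L2/smooth_continuous.
by eexists; exact: smooth_weak_gradient.
Qed.

Lemma weak_gradient_unique u F G : weak_gradient Omega u F -> weak_gradient Omega u G ->
  ae_eq mu Omega F G.
Proof.
move=> [F2 Fu] [G2 Gu].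
have FG i : ae_eq mu Omega (fun x => F x 0 i - G x 0 i) (cst 0).
  apply: fundamental_lemma_calculus_of_variations; first exact: L2B.
  move=> phi tphi; rewrite ipBl//; last exact: test_function_L2.
  by apply/eqP; rewrite subr_eq0 -eqr_opp -Fu// -Gu.
have : {ae mu, forall x i, Omega x -> F x 0 i - G x 0 i = 0} by exact: filter_forall.
apply: filterS => x Fx Ox.
by apply/rowP => i; apply/eqP; rewrite -subr_eq0 Fx.
Qed.

Lemma grad_weak u : H1 Omega u -> weak_gradient Omega u (grad Omega u).
Proof. by move=> [_ /(xgetPex (fun=> 0))]. Qed.

Lemma grad_L2v u : H1 Omega u -> L2v mu Omega (grad Omega u).
Proof. by move=> /grad_weak[]. Qed.

Lemma weak_gradientB u v F G : L2 mu Omega u -> L2 mu Omega v ->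
  weak_gradient Omega u F -> weak_gradient Omega v G ->
  weak_gradient Omega (u - v) (F - G).
Proof.
move=> u2 v2 [F2 Fu] [G2 Gv]; split; first exact: L2vB.
move=> phi i tphi; have phi2 := test_function_L2 tphi.
have dphi2 : L2 mu Omega (partial i phi).
  by case: tphi => sphi _; exact/continuous_L2/smooth_continuous/smooth_partial.
under [X in - ip _ _ X _]eq_fun do rewrite !mxE.
by rewrite !ipBl// Fu// Gv// opprB opprK addrC.
Qed.

Lemma H1B u v : H1 Omega u -> H1 Omega v -> H1 Omega (u - v).
Proof.
move=> /[dup] Hu [u2 [F uF]] /[dup] Hv [v2 [G vG]]; split; first exact: L2B.
by exists (F - G); exact: weak_gradientB.
Qed.

Lemma gradB u v : H1 Omega u -> H1 Omega v ->
  ae_eq mu Omega (grad Omega (u - v)) (grad Omega u - grad Omega v).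
Proof.
move=> Hu Hv; apply: weak_gradient_unique; first exact/grad_weak/H1B.
by apply: weak_gradientB; [case: Hu|case: Hv|exact: grad_weak|exact: grad_weak].
Qed.

(** Lets an explicit weak divergence replace the chosen representative under an integral. *)
Lemma divergence_ae_eq F g : weak_divergence Omega F g ->
  L2 mu Omega (divergence Omega F) /\ ae_eq mu Omega (divergence Omega F) g.
Proof.
move=> Fg; have /(xgetPex (fun=> 0)) : exists q, weak_divergence Omega F q by exists g.
rewrite -/(divergence Omega F) => -[q2 Fq]; split => //.
move: Fg => [g2 Fg].
have : ae_eq mu Omega (fun x => divergence Omega F x - g x) (cst 0).
  apply: fundamental_lemma_calculus_of_variations; first exact: L2B.
  move=> phi tphi; rewrite ipBl//; last exact: test_function_L2.
  by apply/eqP; rewrite subr_eq0 -eqr_opp -Fq// -Fg.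
by apply: filterS => x /[apply] /eqP; rewrite subr_eq0 => /eqP.
Qed.

Lemma test_function_frontier phi x : test_function Omega phi ->
  frontier Omega x -> phi x = 0.
Proof.
move=> tphi [_]; rewrite (interior_id Omega).1// => Ox.
exact: test_function_out tphi Ox.
Qed.

End weak_derivatives.

(** * Measurability of the matrix inverse *)

Section measurable_matrix.
Context {R : realType} {dT} {T : measurableType dT}.
Variables (D : set T) (mD : measurable D).

(** Inversion is continuous off 0; the conventional value 0 at 0 is split off by a case
    distinction. *)
Lemma measurable_inv : measurable_fun setT (@GRing.inv R).
Proof.
rewrite (_ : @GRing.inv R = fun y => if y == 0 then 0 else y^-1); last first.
  by apply/funext => y; case: eqP => // ->; rewrite invr0.
apply: measurable_fun_if => //.
- apply: (measurable_fun_bool true); rewrite setTI.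
  rewrite (_ : _ @^-1` _ = [set 0]); first exact: measurable_set1.
  by apply/seteqP; split => y /= /eqP.
- apply: open_continuous_measurable_fun.
    rewrite setTI (_ : _ @^-1` _ = ~` [set 0]).
      exact/closed_openC/(accessible_closed_set1 (hausdorff_accessible (@Rhausdorff R))).
    by apply/seteqP; split => y /=; [move/negbT/eqP|move/eqP/negbTE].
  by move=> y; rewrite inE => -[_ /= /negbT y0]; exact: inv_continuous.
Qed.

Lemma measurable_det n (M : T -> 'M[R]_n) :
  (forall i j, measurable_fun D (fun x => M x i j)) ->
  measurable_fun D (fun x => \det (M x)).
Proof.
move=> mM; apply: measurable_sum => s; apply: measurable_funM => //.
by apply: measurable_prod => i _; exact: mM.
Qed.

(** [invmx] returns a singular matrix unchanged, so the cofactor formula is used only where the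
    determinant is nonzero; both regions are measurable. The case matters because A is invertible
    only almost everywhere. *)
Lemma measurable_invmx n (M : T -> 'M[R]_n) i j :
  (forall i j, measurable_fun D (fun x => M x i j)) ->
  measurable_fun D (fun x => invmx (M x) i j).
Proof.
move=> mM; have mdet := measurable_det mM.
rewrite (_ : (fun x => _) = fun x =>
    if \det (M x) == 0 then M x i j else (\det (M x))^-1 * cofactor (M x) j i); last first.
  apply/funext => x; rewrite /invmx unitmxE unitfE.
  by case: eqP => //= _; rewrite !mxE.
apply: measurable_fun_if => //.
- apply: (measurable_fun_bool true).
  rewrite (_ : _ @^-1` _ = (fun x => \det (M x)) @^-1` [set 0]).
    by apply: mdet => //; exact: measurable_set1.
  by apply/seteqP; split => x /= /eqP.
- by apply: measurable_funS (mM i j) => // x [].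
- apply: (measurable_funS mD) => [x []//|].
  apply: measurable_funM; first exact: (measurableT_comp measurable_inv mdet).
  apply: measurable_funM => //.
  by apply: measurable_det => k l; under eq_fun do rewrite !mxE; exact: mM.
Qed.

End measurable_matrix.

(** * Action of the coefficients A, b, c on L^2 *)

Section coefficients.
Context {R : realType} {d : nat}.
Variables (P : problem R d) (a0 a1 : R).
Hypotheses (mO : measurable (dom P)) (admC : admissible_coefficients P a0 a1).
Local Notation Omega := (dom P).
Local Notation mu := (lebesgue_rV d).
Implicit Types (F G : 'rV[R]_d -> 'rV[R]_d) (s : 'rV[R]_d -> R).

Lemma a0_gt0 : 0 < a0. Proof. by case: admC => -[]. Qed.

Lemma coefA_ae : {ae mu, forall x, Omega x ->
  [/\ (coefA P x)^T = coefA P x, coefA P x \in unitmx &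
      forall v, enorm (mulmv (invmx (coefA P x)) v) <= a0^-1 * enorm v]}.
Proof.
have [_ _ + _ _] := admC; apply: filterS => x /[apply] -[symA cA]; split => //.
- by apply: (coercive_unitmx a0_gt0) => v; have [] := cA v.
- by move=> v; apply: (coercive_enorm_invmx v a0_gt0) => w; have [] := cA w.
Qed.

Lemma Linf_coefA i j : Linf mu Omega (fun x => coefA P x i j).
Proof. by case: admC. Qed.

(** Entry (i, j) is the i-th coordinate of A^-1 e_j, a vector of length at most a0^-1. *)
Lemma Linf_coefA_inv i j : Linf mu Omega (fun x => invmx (coefA P x) i j).
Proof.
split.
  by apply: measurable_invmx => // k l; have [] := Linf_coefA k l.
exists a0^-1; apply: filterS coefA_ae => x /[apply] -[_ _ /(_ (delta_mx 0 j))].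
rewrite (_ : enorm (delta_mx 0 j) = 1).
  rewrite mulr1; apply: le_trans; apply: le_trans (enorm_ge_coord _ i).
  rewrite mulmv_coord (bigD1 j)//= big1 ?addr0 => [|k kj].
    by rewrite mxE !eqxx mulr1.
  by rewrite mxE (negbTE kj) andbF mulr0.
rewrite /enorm /dotv (bigD1 j)//= big1 ?addr0 => [|k kj].
  by rewrite mxE !eqxx mulr1 sqrtr1.
by rewrite mxE (negbTE kj) andbF mulr0.
Qed.

Lemma L2v_applyA F : L2v mu Omega F -> L2v mu Omega (applyA P F).
Proof. by move=> F2; apply: L2v_mulmv => //; exact: Linf_coefA. Qed.

Lemma L2v_applyAinv F : L2v mu Omega F -> L2v mu Omega (applyAinv P F).
Proof. by move=> F2; apply: L2v_mulmv => //; exact: Linf_coefA_inv. Qed.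

Lemma L2v_scaleb s : L2 mu Omega s -> L2v mu Omega (scaleb P s).
Proof. by move=> s2; apply: Linfv_scale_L2v => //; case: admC. Qed.

Lemma L2_dotb F : L2v mu Omega F -> L2 mu Omega (fun x => dotv (coefb P x) (F x)).
Proof. by move=> F2; apply: Linfv_dotv_L2 => //; case: admC. Qed.

Lemma L2_mulc s : L2 mu Omega s -> L2 mu Omega (fun x => coefc P x * s x).
Proof. by move=> s2; apply: LinfM_L2 => //; case: admC. Qed.

Lemma applyAD F G : applyA P (F + G) = applyA P F + applyA P G.
Proof. by apply/funext => x; exact: mulmvDr. Qed.

Lemma applyAN F : applyA P (- F) = - applyA P F.
Proof. by apply/funext => x; exact: mulmvNr. Qed.

Lemma applyAinvD F G : applyAinv P (F + G) = applyAinv P F + applyAinv P G.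
Proof. by apply/funext => x; exact: mulmvDr. Qed.

Lemma applyAinvN F : applyAinv P (- F) = - applyAinv P F.
Proof. by apply/funext => x; exact: mulmvNr. Qed.

Lemma scalebB s t : scaleb P (s - t) = scaleb P s - scaleb P t.
Proof. by apply/funext => x; exact: scalerBl. Qed.

Let mdotv F G : L2v mu Omega F -> L2v mu Omega G ->
  measurable_fun Omega (fun x => dotv (F x) (G x)).
Proof. by move=> F2 G2; apply: measurable_dotv => i; [case: (F2 i)|case: (G2 i)]. Qed.

Lemma ipv_applyA F G : L2v mu Omega F -> L2v mu Omega G ->
  ipv mu Omega (applyA P F) G = ipv mu Omega F (applyA P G).
Proof.
move=> F2 G2; apply: eq_ae_Rintegral => //.
- by apply: mdotv => //; exact: L2v_applyA.
- by apply: mdotv => //; exact: L2v_applyA.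
by apply: filterS coefA_ae => x /[apply] -[sA _ _]; rewrite dotv_mulmv sA.
Qed.

Lemma ipv_applyAinv F G : L2v mu Omega F -> L2v mu Omega G ->
  ipv mu Omega F (applyAinv P G) = ipv mu Omega (applyAinv P F) G.
Proof.
move=> F2 G2; apply: eq_ae_Rintegral => //.
- by apply: mdotv => //; exact: L2v_applyAinv.
- by apply: mdotv => //; exact: L2v_applyAinv.
by apply: filterS coefA_ae => x /[apply] -[sA _ _]; rewrite dotv_mulmv trmx_inv sA.
Qed.

Lemma ipv_applyAinvA F G : L2v mu Omega F -> L2v mu Omega G ->
  ipv mu Omega (applyAinv P (applyA P F)) G = ipv mu Omega F G.
Proof.
move=> F2 G2; apply: eq_ae_Rintegral => //.
- by apply: mdotv => //; exact/L2v_applyAinv/L2v_applyA.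
- exact: mdotv.
by apply: filterS coefA_ae => x /[apply] -[_ uA _]; rewrite /applyAinv /applyA mulmvK.
Qed.

Lemma ipv_applyAinv_applyA F G : L2v mu Omega F -> L2v mu Omega G ->
  ipv mu Omega (applyAinv P F) (applyA P G) = ipv mu Omega F G.
Proof.
move=> F2 G2; rewrite -ipv_applyA//; last exact: L2v_applyAinv.
apply: eq_ae_Rintegral => //.
- by apply: mdotv => //; exact/L2v_applyA/L2v_applyAinv.
- exact: mdotv.
by apply: filterS coefA_ae => x /[apply] -[_ uA _]; rewrite /applyAinv /applyA mulmvVK.
Qed.

(** Moves [b] off the gradient and onto [s], the form in which it occurs in [adjoint_flux]. *)
Lemma ip_dotb F s : ip mu Omega (fun x => dotv (coefb P x) (F x)) s =
  ipv mu Omega F (scaleb P s).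
Proof. by apply: eq_Rintegral => x _; rewrite dotvZr dotvC mulrC. Qed.

Lemma applyAinv_dotv_le F G : L2v mu Omega F -> L2v mu Omega G ->
  `|ipv mu Omega (applyAinv P F) G| <=
  a0^-1 * (norm0v mu Omega F * norm0v mu Omega G).
Proof.
move=> F2 G2; rewrite !norm0v_enorm; apply: normr_Rintegral_le => //.
- by rewrite invr_ge0 ltW// a0_gt0.
- by apply: mdotv => //; exact: L2v_applyAinv.
- exact: L2_enorm.
- exact: L2_enorm.
apply: filterS coefA_ae => x /[apply] -[_ _ iA].
rewrite !(ger0_norm (enorm_ge0 _)) mulrA.
by rewrite (le_trans (normr_dotv_le _ _))// ler_wpM2r ?enorm_ge0//; exact: iA.
Qed.

Lemma ipv_le F G : L2v mu Omega F -> L2v mu Omega G ->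
  `|ipv mu Omega F G| <= norm0v mu Omega F * norm0v mu Omega G.
Proof.
move=> F2 G2; rewrite !norm0v_enorm -[leRHS]mul1r; apply: normr_Rintegral_le => //.
- exact: mdotv.
- exact: L2_enorm.
- exact: L2_enorm.
apply: aeW => x _; rewrite !(ger0_norm (enorm_ge0 _)) mul1r.
exact: normr_dotv_le.
Qed.

Lemma applyAinv_scaleb_le F s : L2v mu Omega F -> L2 mu Omega s ->
  `|ipv mu Omega (applyAinv P F) (scaleb P s)| <=
  a0^-1 * norm_infv mu Omega (coefb P) * (norm0v mu Omega F * norm0 mu Omega s).
Proof.
move=> F2 s2; rewrite !norm0v_enorm; apply: normr_Rintegral_le => //.
- by rewrite mulr_ge0 ?invr_ge0 ?norm_inf_ge0// ltW// a0_gt0.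
- by apply: mdotv; [exact: L2v_applyAinv|exact: L2v_scaleb].
- exact: L2_enorm.
have bLinf : Linfv mu Omega (coefb P) by case: admC.
apply: filterS2 coefA_ae (norm_infvP bLinf) => x + + Ox.
move=> /(_ Ox)[_ _ iA] /(_ Ox) bx.
rewrite (ger0_norm (enorm_ge0 _)) (le_trans (normr_dotv_le _ _))// enormZ.
rewrite mulrACA; apply: ler_pM; rewrite ?enorm_ge0 ?mulr_ge0 ?enorm_ge0//.
  exact: iA.
by rewrite mulrC ler_wpM2r.
Qed.

Lemma mulc_le s t : L2 mu Omega s -> L2 mu Omega t ->
  `|ip mu Omega (fun x => coefc P x * s x) t| <=
  norm_inf mu Omega (coefc P) * (norm0 mu Omega s * norm0 mu Omega t).
Proof.
move=> s2 t2; apply: normr_Rintegral_le => //.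
- exact: norm_inf_ge0.
- by apply: measurable_funM; [case: (L2_mulc s2)|case: t2].
have [_ [M cM]] : Linf mu Omega (coefc P) by case: admC.
apply: filterS (norm_infP cM) => x /[apply] cx.
by rewrite !normrM -mulrA ler_wpM2r// mulr_ge0.
Qed.

End coefficients.

(* lra compares non-variable atoms up to conversion, which does not terminate
   in reasonable time on integrals. *)
Ltac lra_integrals := repeat match goal with
  | |- context [ip ?m ?D ?f ?g] => generalize (ip m D f g); intro
  | |- context [ipv ?m ?D ?F ?G] => generalize (ipv m D F G); intro
  end; lra.

(** * Traces, weak problems and the quantity of interest *)

Section weak_problem_theory.
Context {R : realType} {d : nat}.
Variables (P : problem R d) (tr : ('rV[R]_d -> R) -> 'rV[R]_d -> R) (a0 a1 : R).
Hypotheses (oO : open (dom P)) (bO : bounded_set (dom P)).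
Hypotheses (bdry : boundary_partition (dom P) (GammaD P) (GammaN P)).
Hypotheses (admC : admissible_coefficients P a0 a1) (admD : admissible_data P).
Hypothesis (trO : trace_operator (dom P) tr).
Local Notation Omega := (dom P).
Local Notation mu := (lebesgue_rV d).
Local Notation grad := (grad Omega).
Local Notation pairN psi s := (ip surface (GammaN P) psi (tr s)).
Implicit Types (s t u v w z phi psi : 'rV[R]_d -> R).

Let mO : measurable Omega. Proof. exact: open_measurable_rV. Qed.

Lemma measurable_frontier : measurable (frontier Omega).
Proof.
apply: measurableD; last by apply: open_measurable_rV; exact: open_interior.
rewrite -(setCK (closure _)); apply: measurableC; apply: open_measurable_rV.
exact/closed_openC/closed_closure.
Qed.

Lemma GammaN_frontier : GammaN P `<=` frontier Omega.
Proof. by case: bdry => _ [U _ ->] _ _ _; exact: subIsetr. Qed.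

Lemma GammaD_frontier : GammaD P `<=` frontier Omega.
Proof. by case: bdry => -[U _ ->] _ _ _ _; exact: subIsetr. Qed.

Lemma measurable_GammaN : measurable (GammaN P).
Proof.
case: bdry => _ [U oU ->] _ _ _.
by apply: measurableI; [exact: open_measurable_rV|exact: measurable_frontier].
Qed.

Lemma L2_traceN s : H1 Omega s -> L2 surface (GammaN P) (tr s).
Proof.
move=> Hs; have [/(_ s Hs)[ms is2] _ _ _] := trO; split.
  by apply: measurable_funS ms; [exact: measurable_frontier|exact: GammaN_frontier].
apply: integrableS is2; [exact: measurable_frontier|exact: measurable_GammaN|].
exact: GammaN_frontier.
Qed.

Lemma traceB s t : H1 Omega s -> H1 Omega t ->
  ae_eq surface (frontier Omega) (tr (s - t)) (fun x => tr s x - tr t x).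
Proof.
move=> Hs Ht; have [_ trD _ _] := trO.
have := trD (-1) t s Ht Hs.
rewrite (_ : (fun x => _) = s - t); last first.
  by apply/funext => x; rewrite mulN1r addrC.
by apply: filterS => x /[apply] ->; rewrite mulN1r addrC.
Qed.

Lemma pairNB psi s t : L2 surface (GammaN P) psi -> H1 Omega s -> H1 Omega t ->
  pairN psi (s - t) = pairN psi s - pairN psi t.
Proof.
move=> psi2 Hs Ht; have mN := measurable_GammaN.
rewrite -ipBr//; [|exact: L2_traceN..].
apply: ip_ae_eq => //.
- exact/L2_traceN/(H1B oO bO).
- by case: psi2.
- by have [] := L2B mN (L2_traceN Hs) (L2_traceN Ht).
- exact: aeW.
- by apply: filterS (traceB Hs Ht) => x sx /GammaN_frontier.
Qed.

Lemma H1_with_valueB phi s t : H1_with_value P tr phi s ->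
  H1_with_value P tr phi t -> HD P tr (s - t).
Proof.
move=> [Hs trs] [Ht trt]; split; first exact: (H1B oO bO).
apply: filterS3 trs trt (traceB Hs Ht) => x sx tx stx Dx.
by rewrite stx ?sx ?tx ?subrr//; exact: GammaD_frontier.
Qed.

(** The trace of a smooth function is its restriction, and an open set does not meet its
    frontier. *)
Lemma trace_test_function phi : test_function Omega phi ->
  ae_eq surface (frontier Omega) (tr phi) (cst 0).
Proof.
move=> tphi; have [_ _ _ trS] := trO; have [sphi _] := tphi.
apply: filterS (trS phi sphi) => x trx Fx.
by rewrite trx// (test_function_frontier oO tphi Fx).
Qed.

Lemma HD_test_function phi : test_function Omega phi -> HD P tr phi.
Proof.
move=> tphi; split; first by apply: (smooth_H1 oO bO); case: tphi.
by apply: filterS (trace_test_function tphi) => x x0 /GammaD_frontier.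
Qed.

Lemma pairN_test_function psi phi : L2 surface (GammaN P) psi ->
  test_function Omega phi -> pairN psi phi = 0.
Proof.
move=> psi2 tphi; have mN := measurable_GammaN.
have Hphi : H1 Omega phi by apply: (smooth_H1 oO bO); case: tphi.
rewrite (@ip_ae_eq _ _ _ _ _ mN _ _ psi (cst 0)) //.
- rewrite /ip /Rintegral (eq_integral (cst 0%E)) ?integral0//.
  by move=> x _ /=; rewrite mulr0.
- exact: L2_traceN.
- by case: psi2.
- exact: aeW.
- by apply: filterS (trace_test_function tphi) => x x0 /GammaN_frontier.
Qed.

(** The lower-order part of the operator; for the primal solution, div sigma = f1 - [reaction u]. *)
Definition reaction u : 'rV[R]_d -> R :=
  fun x => dotv (coefb P x) (grad u x) + coefc P x * u x.

Lemma L2_reaction u : H1 Omega u -> L2 mu Omega (reaction u).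
Proof.
move=> Hu; apply: L2D => //; first by apply: (L2_dotb mO admC); exact: grad_L2v.
by apply: (L2_mulc mO admC); case: Hu.
Qed.

Lemma ip_reaction u s : H1 Omega u -> L2 mu Omega s ->
  ip mu Omega (reaction u) s =
  ipv mu Omega (grad u) (scaleb P s) + ip mu Omega (fun x => coefc P x * u x) s.
Proof.
move=> Hu s2; rewrite /reaction ipDl ?ip_dotb//.
- by apply: (L2_dotb mO admC); exact: grad_L2v.
- by apply: (L2_mulc mO admC); case: Hu.
Qed.

Lemma L2v_flux u : H1 Omega u -> L2v mu Omega (flux P u).
Proof.
move=> Hu; have [_ [f22 _] _ _] := admD; apply: L2vB => //.
by apply: L2vN => //; apply: (L2v_applyA mO admC); exact: grad_L2v.
Qed.

Lemma L2v_adjoint_flux z : H1 Omega z -> L2v mu Omega (adjoint_flux P z).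
Proof.
move=> Hz; have [_ [_ g22] _ _] := admD; apply: L2vN => //; apply: L2vD => //.
apply: L2vD => //; first by apply: (L2v_applyA mO admC); exact: grad_L2v.
by apply: (L2v_scaleb mO admC); case: Hz.
Qed.

(** In the primal equation tested with phi the boundary pairing drops out, since phi has zero trace.
    That equation contains the chosen [grad phi], the definition of weak divergence the classical
    gradient; uniqueness of weak gradients reconciles them. *)
Lemma weak_divergence_flux u : primal_solution P tr u ->
  weak_divergence Omega (flux P u) (fun x => f1 P x - reaction u x).
Proof.
move=> [[Hu _] solu]; have [[f12 _] [f22 _] [psi2 _] _] := admD.
split; first by apply: L2B => //; exact: L2_reaction.
move=> phi tphi; have [sphi _] := tphi.
have Hphi := smooth_H1 oO bO sphi.
have phi2 := test_function_L2 oO bO tphi.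
have gphi2 := grad_L2v Hphi.
have Agu2 := L2v_applyA mO admC (grad_L2v Hu).
have wphi := smooth_weak_gradient oO bO sphi.
rewrite -(@ipv_ae_eq _ _ _ _ _ _ mO (flux P u) (grad phi)) //.
- have := solu _ (HD_test_function tphi).
  rewrite /aform /ell pairN_test_function// subr0 -/(reaction u) => E.
  rewrite ipBl//; last exact: L2_reaction.
  rewrite /flux ipvBl//; last exact: L2vN.
  by rewrite ipvNl//; lra.
- exact: L2v_flux.
- exact: L2v_flux.
- by case: wphi.
- exact: aeW.
- exact: (weak_gradient_unique oO bO (grad_weak Hphi) wphi).
Qed.

Lemma aformBr t s s' : H1 Omega t -> H1 Omega s -> H1 Omega s' ->
  aform P t (s - s') =
  ipv mu Omega (grad t) (applyA P (grad s)) -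
  ipv mu Omega (grad t) (applyA P (grad s')) +
  ip mu Omega (reaction t) s - ip mu Omega (reaction t) s'.
Proof.
move=> Ht Hs Hs'; have [gt2 gs2 gs2'] := And3 (grad_L2v Ht) (grad_L2v Hs) (grad_L2v Hs').
have At2 := L2v_applyA mO admC gt2.
have Hss := H1B oO bO Hs Hs'.
rewrite /aform -/(reaction t).
rewrite (@ipv_ae_eq _ _ _ _ _ _ mO _ _ (applyA P (grad t)) (grad s - grad s')) //.
- rewrite ipvBr// !(ipv_applyA mO admC)// -[RHS]addrA; congr (_ + _).
  by apply: (@ipBr _ _ _ _ _ mO s s' (reaction t)); [case: Hs|case: Hs'|exact: L2_reaction].
- exact: grad_L2v.
- exact: L2vB.
- exact: aeW.
- exact: gradB.
Qed.

Lemma ellB s s' : H1 Omega s -> H1 Omega s' ->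
  ell P tr (s - s') = ip mu Omega (f1 P) s - ip mu Omega (f1 P) s' -
    (ipv mu Omega (f2 P) (grad s) - ipv mu Omega (f2 P) (grad s')) -
    (pairN (psip P) s - pairN (psip P) s').
Proof.
move=> Hs Hs'; have [[f12 _] [f22 _] [psi2 _] _] := admD.
rewrite /ell pairNB//; congr (_ - _ - _).
  by apply: (@ipBr _ _ _ _ _ mO s s') => //; [case: Hs|case: Hs'].
rewrite (@ipv_ae_eq _ _ _ _ _ _ mO _ _ (f2 P) (grad s - grad s')) //.
- by rewrite ipvBr//; exact: grad_L2v.
- exact/grad_L2v/(H1B oO bO).
- by apply: L2vB => //; exact: grad_L2v.
- exact: aeW.
- exact: gradB.
Qed.

Lemma emmB s s' : H1 Omega s -> H1 Omega s' ->
  emm P tr (s - s') = ip mu Omega (g1 P) s - ip mu Omega (g1 P) s' -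
    (ipv mu Omega (grad s) (g2 P) - ipv mu Omega (grad s') (g2 P)) -
    (pairN (psid P) s - pairN (psid P) s').
Proof.
move=> Hs Hs'; have [[_ g12] [_ g22] [_ psi2] _] := admD.
rewrite /emm pairNB//; congr (_ - _ - _).
  by apply: (@ipBr _ _ _ _ _ mO s s') => //; [case: Hs|case: Hs'].
rewrite (@ipv_ae_eq _ _ _ _ _ _ mO _ _ (g2 P) (grad s - grad s')) //.
- by rewrite ipvBr//; [rewrite !(ipvC _ _ (g2 P))|exact: grad_L2v..].
- exact/grad_L2v/(H1B oO bO).
- by apply: L2vB => //; exact: grad_L2v.
- exact: aeW.
- exact: gradB.
Qed.

(** Here the first argument is the test function, so both [A] and [b] are moved onto [s]; A grad s +
    b s is the combination that enters [adjoint_flux]. *)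
Lemma aformBl t t' s : H1 Omega t -> H1 Omega t' -> H1 Omega s ->
  aform P (t - t') s =
  ipv mu Omega (grad t) (applyA P (grad s) + scaleb P s) -
  ipv mu Omega (grad t') (applyA P (grad s) + scaleb P s) +
  ip mu Omega (fun x => coefc P x * t x) s -
  ip mu Omega (fun x => coefc P x * t' x) s.
Proof.
move=> Ht Ht' Hs; have [gt2 gt2' gs2] := And3 (grad_L2v Ht) (grad_L2v Ht') (grad_L2v Hs).
have [s2 t2 t2'] : [/\ L2 mu Omega s, L2 mu Omega t & L2 mu Omega t'].
  by split; [case: Hs|case: Ht|case: Ht'].
have As2 := L2v_applyA mO admC gs2; have bs2 := L2v_scaleb mO admC s2.
have Htt := H1B oO bO Ht Ht'; have gtt2 := grad_L2v Htt.
have D2 : L2v mu Omega (applyA P (grad s) + scaleb P s) by exact: L2vD.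
rewrite /aform -/(reaction (t - t')) ip_reaction// (ipv_applyA mO admC)// addrA -ipvDr//.
rewrite (@ipv_ae_eq _ _ _ _ _ _ mO _ _ (grad t - grad t')
  (applyA P (grad s) + scaleb P s)) //.
- rewrite ipvBl// -[RHS]addrA; congr (_ + _).
  rewrite -ipBl//; [|exact: (L2_mulc mO admC)..].
  by apply: eq_Rintegral => x _; rewrite -mulrBr.
- exact: L2vB.
- exact: gradB.
- exact: aeW.
Qed.

(** Exchanging zd for z changes the value by ell(z - zd) - a(u, z - zd), which is 0. *)
Lemma JpE u zd z : primal_solution P tr u -> Xd P tr zd -> Xd P tr z ->
  Jp P tr u zd =
  ip mu Omega (g1 P) u - ipv mu Omega (grad u) (g2 P) - pairN (psid P) u
  - ipv mu Omega (grad u) (applyA P (grad z)) - ipv mu Omega (f2 P) (grad z)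
  + ip mu Omega (f1 P) z - ip mu Omega (reaction u) z - pairN (psip P) z.
Proof.
move=> solu [/[dup] Hzd [zd2 _] trzd] [/[dup] Hz [z2 _] trz].
have [[Hu _] eqs] := solu.
have [[f12 _] [f22 _] _ _] := admD.
have := eqs _ (H1_with_valueB (conj Hz trz) (conj Hzd trzd)).
rewrite aformBr// ellB// => E.
have r2 := L2_reaction Hu; have q2 : L2 mu Omega (fun x => f1 P x - reaction u x).
  exact: (L2B mO f12 r2).
have [dv2 dvE] := divergence_ae_eq oO bO (weak_divergence_flux solu).
have Au2 := L2v_applyA mO admC (grad_L2v Hu); have gzd2 := grad_L2v Hzd.
rewrite /Jp /normal_flux_pairing (ipvC _ _ (g2 P)).
rewrite (@ip_ae_eq _ _ _ _ _ mO (divergence Omega (flux P u)) zd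
  (fun x => f1 P x - reaction u x) zd)//; last 3 first.
- by case: q2.
- by case: zd2.
- exact: aeW.
rewrite ipBl// /flux ipvBl//; last exact: L2vN.
rewrite ipvNl// (ipv_applyA mO admC)//; last exact: grad_L2v.
move: E; lra_integrals.
Qed.

End weak_problem_theory.

(** * The error formulas as abstract bilinear identities *)

Section bilinear_identities.
Context {R : realType} {X : Type} {d : nat}.
Local Notation V := (X -> 'rV[R]_d).
Variables (S : V -> Prop) (B : V -> V -> R).
Hypotheses (SD : forall x y, S x -> S y -> S (x + y)).
Hypotheses (SN : forall x, S x -> S (- x)).
Hypotheses (BDl : forall x y q, S x -> S y -> S q -> B (x + y) q = B x q + B y q).
Hypotheses (BDr : forall x y p, S x -> S y -> S p -> B p (x + y) = B p x + B p y).
Hypotheses (BNl : forall x q, S x -> S q -> B (- x) q = - B x q).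
Hypotheses (BNr : forall x p, S x -> S p -> B p (- x) = - B p x).
Variables (u w u' w' f t z v bz bv g rho : V).
Hypotheses (Su : S u) (Sw : S w) (Su' : S u') (Sw' : S w').
Hypotheses (uu' : forall q, S q -> B u q = B u' q).
Hypotheses (ww' : forall q, S q -> B w q = B w' q).
Hypotheses (Sf : S f) (St : S t) (Sz : S z) (Sv : S v).
Hypotheses (Sbz : S bz) (Sbv : S bv) (Sg : S g) (Srho : S rho).

Ltac expand := rewrite ?(BDl, BDr, BNl, BNr, uu', ww');
  try by repeat first [assumption | apply: SD | apply: SN].

(** To be read with [u], [w], [f], [t] as A^-1 A grad u, A^-1 A grad w, A^-1 f2, A^-1 tau and [z],
    [v] as A grad z, A grad v. The primed [u'], [w'] are grad u, grad w, interchangeable with [u],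
    [w] only under [B]. The left side is the vector part of [gamma1] plus that of the claimed error;
    [t] and [rho] cancel from it. *)
Lemma corrected_value_expansion :
  B (t + f) g + B f (rho + bv + g) - B (t + f) (rho + g) + B (t + w + f) rho
  + B t (rho + g + v + bv) +
  (B (- u - f - t) (- (z + bz + g) - rho) + B (t + w + f) (- (z + bz + g) - rho) +
   B (- u - f - t) (rho + g + v + bv)) =
  B u' z + B u' bz - B w' z - B w' bz - B w' g - B u' v - B u' bv - B f v.
Proof. by expand; lra. Qed.

(** Uses tau + A grad w + f2 = -(sigma - tau) - A grad(u - w) and rho + g2 + A grad v + b v = -(r -
    rho) - A grad(z - v) - b (z - v). Each substitution yields one more -(A^-1(sigma - tau), r -
    rho), which turns the coefficient +1 of the first formula into -1. *)
Lemma residual_exchange :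
  B (- u - f - t) (- (z + bz + g) - rho) + B (t + w + f) (- (z + bz + g) - rho) +
  B (- u - f - t) (rho + g + v + bv) =
  - B (- u - f - t) (- (z + bz + g) - rho) - B (u' - w') (- (z + bz + g) - rho) -
  B (- u - f - t) (z - v + (bz - bv)).
Proof. by expand; lra. Qed.

End bilinear_identities.

(** The products E r, E h1, e1 r, e1 h1 add up to (E + e1)(r + h1), and each term is bounded by a
    coefficient times one of them: a for t1, c for t2, 1 for t3 and t4, a b for t5. As t3 and t4 use
    different products, a single 1 in the constant serves both. *)
Lemma error_terms_le {R : realFieldType} (t1 t2 t3 t4 t5 a b c E e ge e1 r h gh h1 : R) :
  e <= e1 -> ge <= e1 -> h <= h1 -> gh <= h1 ->
  0 <= a -> 0 <= b -> 0 <= c -> 0 <= E -> 0 <= r -> 0 <= e -> 0 <= h ->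
  0 <= ge -> 0 <= gh ->
  `|t5| <= a * b * (E * h) -> `|t4| <= E * gh -> `|t3| <= ge * r ->
  `|t2| <= c * (e * h) -> `|t1| <= a * (E * r) ->
  `|- t1 + t2 - t3 - (t4 + t5)| <= (1 + a + c + a * b) * (E + e1) * (r + h1).
Proof.
move=> ee1 gee1 hh1 ghh1 a0 b0 c0 E0 r0 e0 h0 ge0 gh0 T5 T4 T3 T2 T1.
have e10 := le_trans e0 ee1; have h10 := le_trans h0 hh1.
have ab0 := mulr_ge0 a0 b0.
have Er : 0 <= E * r by exact: mulr_ge0.
have Eh : 0 <= E * h1 by exact: mulr_ge0.
have er : 0 <= e1 * r by exact: mulr_ge0.
have eh : 0 <= e1 * h1 by exact: mulr_ge0.
have {}T5 : `|t5| <= a * b * (E * h1) by rewrite (le_trans T5)// !ler_wpM2l.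
have {}T4 : `|t4| <= E * h1 by rewrite (le_trans T4)// ler_wpM2l.
have {}T3 : `|t3| <= e1 * r by rewrite (le_trans T3)// ler_wpM2r.
have {}T2 : `|t2| <= c * (e1 * h1) by rewrite (le_trans T2)// ler_wpM2l// ler_pM.
have tri : `|- t1 + t2 - t3 - (t4 + t5)| <= `|t1| + `|t2| + `|t3| + `|t4| + `|t5|.
  have absE (t : R) : (- `|t| <= t) /\ (t <= `|t|) by apply/andP; rewrite -ler_norml.
  have [? ?] := absE t1; have [? ?] := absE t2; have [? ?] := absE t3.
  have [? ?] := absE t4; have [? ?] := absE t5.
  by rewrite ler_norml; apply/andP; split; lra.
apply: (le_trans tri).
have -> : (1 + a + c + a * b) * (E + e1) * (r + h1) =
    (1 + a + c + a * b) * (E * r + E * h1 + e1 * r + e1 * h1) by ring.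
(* The nine products of a, c or a b with a factor that occurs in none of the bounds; [lra] is linear
   and needs their signs as hypotheses. *)
have := mulr_ge0 a0 Eh; have := mulr_ge0 a0 er; have := mulr_ge0 a0 eh.
have := mulr_ge0 c0 Er; have := mulr_ge0 c0 Eh; have := mulr_ge0 c0 er.
have := mulr_ge0 ab0 Er; have := mulr_ge0 ab0 er; have := mulr_ge0 ab0 eh.
move: (E * r) (E * h1) (e1 * r) (e1 * h1) Er Eh er eh T1 T2 T3 T4 T5 => p q s t.
lra.
Qed.

(** * The two error formulas and the bound *)

Section error_representation.
Context {R : realType} {d : nat}.
Variables (P : problem R d) (tr : ('rV[R]_d -> R) -> 'rV[R]_d -> R) (a0 a1 : R).
Hypotheses (oO : open (dom P)) (bO : bounded_set (dom P)).
Hypotheses (bdry : boundary_partition (dom P) (GammaD P) (GammaN P)).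
Hypotheses (admC : admissible_coefficients P a0 a1) (admD : admissible_data P).
Hypothesis (trO : trace_operator (dom P) tr).
Variables (u z zd w v : 'rV[R]_d -> R) (tau rho : 'rV[R]_d -> 'rV[R]_d).
Hypotheses (solu : primal_solution P tr u) (solz : adjoint_solution P tr z).
Hypotheses (Xzd : Xd P tr zd) (Xw : Xp P tr w) (Xv : Xd P tr v).
Hypotheses (tau2 : L2v (lebesgue_rV d) (dom P) tau).
Hypotheses (rho2 : L2v (lebesgue_rV d) (dom P) rho).
Local Notation Omega := (dom P).
Local Notation mu := (lebesgue_rV d).
Local Notation grad := (grad Omega).
Local Notation ip := (ip mu Omega).
Local Notation ipv := (ipv mu Omega).
Local Notation pairN psi s := (Defs.ip surface (GammaN P) psi (tr s)).
Local Notation sigma := (flux P u).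
Local Notation r := (adjoint_flux P z).

Let mO : measurable Omega. Proof. exact: open_measurable_rV. Qed.
Let Hu : H1 Omega u. Proof. by case: solu => -[]. Qed.
Let Hz : H1 Omega z. Proof. by case: solz => -[]. Qed.
Let Hw : H1 Omega w. Proof. by case: Xw. Qed.
Let Hv : H1 Omega v. Proof. by case: Xv. Qed.
Let u2 : L2 mu Omega u. Proof. by case: Hu. Qed.
Let z2 : L2 mu Omega z. Proof. by case: Hz. Qed.
Let w2 : L2 mu Omega w. Proof. by case: Hw. Qed.
Let v2 : L2 mu Omega v. Proof. by case: Hv. Qed.
Let gu2 : L2v mu Omega (grad u). Proof. exact: grad_L2v. Qed.
Let gz2 : L2v mu Omega (grad z). Proof. exact: grad_L2v. Qed.
Let gw2 : L2v mu Omega (grad w). Proof. exact: grad_L2v. Qed.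
Let gv2 : L2v mu Omega (grad v). Proof. exact: grad_L2v. Qed.
Let f22 : L2v mu Omega (f2 P). Proof. by case: admD => _ []. Qed.
Let g22 : L2v mu Omega (g2 P). Proof. by case: admD => _ []. Qed.

Ltac L2v_tac := repeat lazymatch goal with
  | |- L2v _ _ (_ + _) => apply: (L2vD mO)
  | |- L2v _ _ (- _) => apply: (L2vN mO)
  | |- L2v _ _ (applyAinv _ _) => apply: (L2v_applyAinv mO admC)
  | |- L2v _ _ (applyA _ _) => apply: (L2v_applyA mO admC)
  | |- L2v _ _ (scaleb _ _) => apply: (L2v_scaleb mO admC)
  | |- L2 _ _ (fun x => _ * _) => apply: (L2_mulc mO admC)
  | |- L2v _ _ _ => assumption
  | |- L2 _ _ _ => assumption
  end.

(* Unlike generalize, [move:] identifies terms that differ by the path to the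
   additive structure of functions. *)
Ltac lra_products :=
  match goal with |- context [@Defs.ipv ?R ?dT ?T ?m ?D ?d] =>
    let B := fresh in move: (@Defs.ipv R dT T m D d) => B;
    repeat match goal with |- context [B ?F ?G] => move: (B F G) => ? end
  end; lra_integrals.

(** The primal equation tested with z - v. Pairings with f2 are written as (A^-1 f2, A grad .), to
    agree with the terms of the bilinear identities. *)
Let primal_eq :
  ipv (grad u) (applyA P (grad z)) - ipv (grad u) (applyA P (grad v)) +
  ipv (grad u) (scaleb P z) + ip (fun x => coefc P x * u x) z -
  (ipv (grad u) (scaleb P v) + ip (fun x => coefc P x * u x) v) =
  ip (f1 P) z - ip (f1 P) v -
  (ipv (applyAinv P (f2 P)) (applyA P (grad z)) -
   ipv (applyAinv P (f2 P)) (applyA P (grad v))) -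
  (pairN (psip P) z - pairN (psip P) v).
Proof.
have := solu.2 _ (H1_with_valueB oO bO bdry trO solz.1 Xv).
rewrite (aformBr oO bO admC)// (ellB oO bO bdry admD trO)//.
by rewrite !(ip_reaction oO admC)// !(ipv_applyAinv_applyA mO admC)//; lra_integrals.
Qed.

Let adjoint_eq :
  ipv (grad u) (applyA P (grad z)) + ipv (grad u) (scaleb P z) -
  (ipv (grad w) (applyA P (grad z)) + ipv (grad w) (scaleb P z)) +
  ip (fun x => coefc P x * u x) z - ip (fun x => coefc P x * w x) z =
  ip (g1 P) u - ip (g1 P) w - (ipv (grad u) (g2 P) - ipv (grad w) (g2 P)) -
  (pairN (psid P) u - pairN (psid P) w).
Proof.
have := solz.2 _ (H1_with_valueB oO bO bdry trO solu.1 Xw).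
rewrite (aformBl oO bO admC)// (emmB oO bO bdry admD trO)//.
by rewrite !(ipvDr mO)//; L2v_tac.
Qed.

Let ip_c : ip (coefc P * (u - w)) (z - v) =
  ip (fun x => coefc P x * u x) z - ip (fun x => coefc P x * u x) v -
  (ip (fun x => coefc P x * w x) z - ip (fun x => coefc P x * w x) v).
Proof.
have cu2 := L2_mulc mO admC u2; have cw2 := L2_mulc mO admC w2.
rewrite -!(ipBr mO)// -(ipBl mO)//; last exact: L2B.
by apply: eq_Rintegral => x _; rewrite -mulrBr.
Qed.

Let Au2 := L2v_applyAinv mO admC (L2v_applyA mO admC gu2).
Let Aw2 := L2v_applyAinv mO admC (L2v_applyA mO admC gw2).
Let Af2 := L2v_applyAinv mO admC f22.
Let At2 := L2v_applyAinv mO admC tau2.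
Let Az2 := L2v_applyA mO admC gz2.
Let Av2 := L2v_applyA mO admC gv2.
Let bz2 := L2v_scaleb mO admC z2.
Let bv2 := L2v_scaleb mO admC v2.

Let expansion := @corrected_value_expansion R 'rV[R]_d d (@L2v R _ _ mu Omega d) ipv
  (L2vD mO) (L2vN mO)
  (fun F G H F2 G2 H2 => ipvDl mO F2 G2 H2) (fun F G H F2 G2 H2 => ipvDr mO F2 G2 H2)
  (fun F G F2 G2 => ipvNl mO F2 G2) (fun F G F2 G2 => ipvNr mO F2 G2).

Lemma error_first_form : Jp P tr u zd - gamma1 P tr w tau v rho =
  ipv (applyAinv P (sigma - tau)) (r - rho) + ip (coefc P * (u - w)) (z - v) +
  ipv (tau + applyA P (grad w) + f2 P) (applyAinv P (r - rho)) +
  ipv (applyAinv P (sigma - tau)) (rho + g2 P + applyA P (grad v) + scaleb P v).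
Proof.
have E1 := primal_eq; have E2 := adjoint_eq.
rewrite (JpE oO bO bdry admC admD trO solu Xzd solz.1) ip_c.
rewrite /gamma1 /gamma1_tilde /emm_tilde /ell_tilde /a_tilde.
rewrite /flux /adjoint_flux (ip_reaction oO admC)//.
rewrite -(ipv_applyAinv_applyA mO admC f22 gz2).
rewrite !(ipv_applyAinv mO admC); try by L2v_tac.
rewrite -[Defs.ip _ _ (coefc P * w) v]/(ip (fun x => coefc P x * w x) v).
rewrite !(applyAinvD, applyAinvN).
have := @expansion _ _ (grad u) (grad w) (applyAinv P (f2 P)) (applyAinv P tau)
  (applyA P (grad z)) (applyA P (grad v)) (scaleb P z) (scaleb P v) (g2 P) rho
  Au2 Aw2 gu2 gw2 (fun F F2 => ipv_applyAinvA mO admC gu2 F2)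
  (fun F F2 => ipv_applyAinvA mO admC gw2 F2) Af2 At2 Az2 Av2 bz2 bv2 g22 rho2.
(* [E1] accounts for f1 and psip, [E2] for g1 and psid, the expansion for tau and rho; the goal is a
   linear combination of the three. *)
move: E1 E2; lra_products.
Qed.

Let exchange := @residual_exchange R 'rV[R]_d d (@L2v R _ _ mu Omega d) ipv
  (L2vD mO) (L2vN mO)
  (fun F G H F2 G2 H2 => ipvDl mO F2 G2 H2) (fun F G H F2 G2 H2 => ipvDr mO F2 G2 H2)
  (fun F G F2 G2 => ipvNl mO F2 G2) (fun F G F2 G2 => ipvNr mO F2 G2).

Lemma error_second_form : Jp P tr u zd - gamma1 P tr w tau v rho =
  - ipv (applyAinv P (sigma - tau)) (r - rho) + ip (coefc P * (u - w)) (z - v)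
  - ipv (grad (u - w)) (r - rho)
  - ipv (sigma - tau) (grad (z - v) + applyAinv P (scaleb P (z - v))).
Proof.
rewrite error_first_form.
have guw2 := grad_L2v (H1B oO bO Hu Hw); have gzv2 := grad_L2v (H1B oO bO Hz Hv).
have rr2 : L2v mu Omega (r - rho).
  by apply: (L2vB mO) => //; exact: (L2v_adjoint_flux oO admC).
have ss2 : L2v mu Omega (sigma - tau).
  by apply: (L2vB mO) => //; exact: (L2v_flux oO admC).
have bzv2 : L2v mu Omega (scaleb P (z - v)) by rewrite scalebB; L2v_tac.
have gz_v2 := L2vB mO gz2 gv2.
have Tuw : ipv (grad (u - w)) (r - rho) = ipv (grad u - grad w) (r - rho).
  apply: (ipv_ae_eq mO) => //; [exact: (L2vB mO)|exact: (gradB oO bO)|exact: aeW].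
have Tzv : ipv (sigma - tau) (grad (z - v)) = ipv (sigma - tau) (grad z - grad v).
  by apply: (ipv_ae_eq mO) => //; [exact: aeW|exact: (gradB oO bO)].
rewrite (ipvDr mO gzv2 (L2v_applyAinv mO admC bzv2) ss2) Tuw Tzv.
(* Both pairings with sigma - tau get A^-1 on the left, so that they merge into one with second
   factor A grad(z - v) + b (z - v). *)
rewrite -(ipv_applyAinv_applyA mO admC ss2 gz_v2) (ipv_applyAinv mO admC ss2 bzv2).
rewrite (ipv_applyAinv mO admC _ rr2); last by L2v_tac.
rewrite -(ipvDr mO _ bzv2); last 2 first.
- exact: (L2v_applyA mO admC).
- exact: (L2v_applyAinv mO admC).
rewrite /flux /adjoint_flux scalebB !(applyAinvD, applyAinvN, applyAD, applyAN).
have := @exchange _ _ (grad u) (grad w) (applyAinv P (f2 P)) (applyAinv P tau)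
  (applyA P (grad z)) (applyA P (grad v)) (scaleb P z) (scaleb P v) (g2 P) rho
  Au2 Aw2 gu2 gw2 (fun F F2 => ipv_applyAinvA mO admC gu2 F2)
  (fun F F2 => ipv_applyAinvA mO admC gw2 F2) Af2 At2 Az2 Av2 bz2 bv2 g22 rho2.
lra_products.
Qed.

Lemma error_bound : `|Jp P tr u zd - gamma1 P tr w tau v rho| <=
  (1 + a0^-1 + norm_inf mu Omega (coefc P) +
   a0^-1 * norm_infv mu Omega (coefb P)) *
  (norm0v mu Omega (sigma - tau) + norm1 Omega (u - w)) *
  (norm0v mu Omega (r - rho) + norm1 Omega (z - v)).
Proof.
have Huw := H1B oO bO Hu Hw; have Hzv := H1B oO bO Hz Hv.
have guw2 := grad_L2v Huw; have gzv2 := grad_L2v Hzv.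
have uw2 : L2 mu Omega (u - w) by exact: L2B.
have zv2 : L2 mu Omega (z - v) by exact: L2B.
have rr2 : L2v mu Omega (r - rho).
  by apply: (L2vB mO) => //; exact: (L2v_adjoint_flux oO admC).
have ss2 : L2v mu Omega (sigma - tau).
  by apply: (L2vB mO) => //; exact: (L2v_flux oO admC).
have bzv2 : L2v mu Omega (scaleb P (z - v)) by exact: (L2v_scaleb mO admC).
have norm1_ge s : norm0 mu Omega s <= norm1 Omega s /\
    norm0v mu Omega (grad s) <= norm1 Omega s.
  split; rewrite /norm1 -[leLHS]ger0_norm ?sqrtr_ge0// -sqrtr_sqr ler_wsqrtr//.
    by rewrite lerDl sqr_ge0.
  by rewrite lerDr sqr_ge0.
rewrite error_second_form (ipvDr mO gzv2)//; last exact: (L2v_applyAinv mO admC).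
have T1 := applyAinv_dotv_le mO admC ss2 rr2.
have T2 : `|ip (coefc P * (u - w)) (z - v)| <= _ := mulc_le mO admC uw2 zv2.
have T3 := ipv_le mO guw2 rr2.
have T4 := ipv_le mO ss2 gzv2.
have T5 := applyAinv_scaleb_le mO admC ss2 zv2.
rewrite (ipv_applyAinv mO admC ss2 bzv2).
have [e1 e2] := norm1_ge (u - w); have [h1 h2] := norm1_ge (z - v).
have a00 : 0 <= a0^-1 by rewrite invr_ge0 ltW// (a0_gt0 admC).
have b0 : 0 <= norm_infv mu Omega (coefb P) by exact: norm_inf_ge0.
have c0 : 0 <= norm_inf mu Omega (coefc P) by exact: norm_inf_ge0.
have s0 : 0 <= norm0v mu Omega (sigma - tau) by exact: sqrtr_ge0.
have r0 : 0 <= norm0v mu Omega (r - rho) by exact: sqrtr_ge0.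
have uw0 : 0 <= norm0 mu Omega (u - w) by exact: sqrtr_ge0.
have zv0 : 0 <= norm0 mu Omega (z - v) by exact: sqrtr_ge0.
have guw0 : 0 <= norm0v mu Omega (grad (u - w)) by exact: sqrtr_ge0.
have gzv0 : 0 <= norm0v mu Omega (grad (z - v)) by exact: sqrtr_ge0.
by apply: (error_terms_le e1 e2 h1 h2 a00 b0 c0 s0 r0 uw0 zv0 guw0 gzv0 T5 T4 T3 T2 T1).
Qed.

End error_representation.

Theorem theorem4p2 (R : realType) :
  exists C : R -> R -> R -> R,
  forall (d : nat) (P : problem R d)
    (tr : ('rV[R]_d -> R) -> 'rV[R]_d -> R) (a0 a1 beta : R),
  (2 <= d)%N ->
  bounded_lipschitz_domain (dom P) ->
  boundary_partition (dom P) (GammaD P) (GammaN P) ->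
  admissible_coefficients P a0 a1 ->
  admissible_data P ->
  trace_operator (dom P) tr ->
  0 < beta -> inf_sup P tr beta ->
  forall u z : 'rV[R]_d -> R,
  primal_solution P tr u ->
  adjoint_solution P tr z ->
  forall zd : 'rV[R]_d -> R, Xd P tr zd ->
  forall w v : 'rV[R]_d -> R, Xp P tr w -> Xd P tr v ->
  forall tau rho : 'rV[R]_d -> 'rV[R]_d,
  L2v (lebesgue_rV d) (dom P) tau -> L2v (lebesgue_rV d) (dom P) rho ->
  let ip := ip (lebesgue_rV d) (dom P) in
  let ipv := ipv (d := d) (lebesgue_rV d) (dom P) in
  let norm0v := norm0v (d := d) (lebesgue_rV d) (dom P) in
  let norm1 := norm1 (dom P) in
  let grad := grad (dom P) in
  let sigma := flux P u in
  let r := adjoint_flux P z in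
  let gamma := Jp P tr u zd in
  let err := gamma - gamma1 P tr w tau v rho in
  [/\ err = ipv (applyAinv P (sigma - tau)) (r - rho)
             + ip (coefc P * (u - w)) (z - v)
             + ipv (tau + applyA P (grad w) + f2 P) (applyAinv P (r - rho))
             + ipv (applyAinv P (sigma - tau))
                   (rho + g2 P + applyA P (grad v) + scaleb P v),
      err = - ipv (applyAinv P (sigma - tau)) (r - rho)
            + ip (coefc P * (u - w)) (z - v)
            - ipv (grad (u - w)) (r - rho)
            - ipv (sigma - tau)
                  (grad (z - v) + applyAinv P (scaleb P (z - v))) &
      `|err| <= C a0^-1 (norm_infv (lebesgue_rV d) (dom P) (coefb P))
                        (norm_inf (lebesgue_rV d) (dom P) (coefc P))
                * (norm0v (sigma - tau) + norm1 (u - w))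
                * (norm0v (r - rho) + norm1 (z - v))].
Proof.
(* The arguments stand for a0^-1 and the sup norms of b and c; x * y comes from the term with A^-1 b
   (z - v), and 1 from the two terms without a coefficient. *)
exists (fun x y z => 1 + x + z + x * y).
move=> d P tr a0 a1 beta _ [oO _ bO _] bdry admC admD trO _ _ u z solu solz.
move=> zd Xzd w v Xw Xv tau rho tau2 rho2 /=; split.
- exact: (error_first_form oO bO bdry admC admD trO).
- exact: (error_second_form oO bO bdry admC admD trO).
- exact: (error_bound oO bO bdry admC admD trO).
Qed.
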